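(* Assume the hypotheses (a)–(d) of the setting below, and in addition: (e) $\Theta$ is finite; (f) for all $\theta_1<\theta_2$ in $\Theta$, $$\inf_{\theta>\theta_2}\sup_{x\in\mathbf X} I(\theta_1,\theta\mid x)=\sup_{x\in\mathbf X}\inf_{\theta>\theta_2} I(\theta_1,\theta\mid x),$$ and symmetrically with the roles of $\theta_1,\theta_2$ exchanged. Then there exists a uniformly good allocation rule $\{\phi_\tau\}$ such that for every $C_0=(\theta_1,\theta_2)\in\Theta^2$ with $\theta_1\ne\theta_2$, $$\limsup_{t\to\infty}\frac{\mathsf E_{C_0}\{T_{inf}(t)\}}{\log t}\le\frac1{K_{C_0}},$$ where $K_{C_0}=\inf_{\theta>\theta_2}\sup_x I(\theta_1,\theta\mid x)$ if $\theta_1<\theta_2$ and $K_{C_0}=\inf_{\theta>\theta_1}\sup_x I(\theta_2,\theta\mid x)$ if $\theta_1>\theta_2$; i.e. this rule attains the lower bound of the preceding lower-bound theorem and is asymptotically optimal.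
   Context: Two-armed bandit with side observations. $\Theta\subset\mathbb R$ is a parameter set and $\mathbf X\subset\mathbb R$. Known conditional distributions $\{F_\theta(dy\mid x)\}_{\theta\in\Theta}$ on $\mathbb R$ and a known law $G$ on $\mathbf X$. Under configuration $C_0=(\theta_1,\theta_2)\in\Theta^2$, $X_1,X_2,\dots$ are i.i.d. with law $G$, and for each arm $i$ the pairs $(X_t,Y^i_t)$ are i.i.d. with joint law $G(dx)F_{\theta_i}(dy\mid x)$. An allocation rule is $\phi_t\in\{1,2\}$ depending only on $X_1,\dots,X_t$ and previously observed rewards $Y^{\phi_\tau}_\tau$, $\tau<t$. Standing hypotheses: (a) $G$ does not depend on the configuration; (b) $\mathbf X$ is finite and $\mathsf P_G(X_t=x)>0$ for all $x$; (c) $0<I(\theta,\vartheta\mid x)<\infty$ for all $\theta\ne\vartheta$ and all $x$; (d) for every $x$, $\theta\mapsto\mu_\theta(x)=\int yF_\theta(dy\mid x)$ is strictly increasing. $M_C(x)=\arg\max_i\mu_{i(C)}(x)$ with $1(C)=\theta_1,2(C)=\theta_2$; $T_{inf}(t)=\sum_{\tau\le t}1\{\phi_\tau\ne M_{C_0}(X_\tau)\}$. $I(\theta,\vartheta\mid x)$ is the Kullback–Leibler number between $F_\theta(\cdot\mid x)$ and $F_\vartheta(\cdot\mid x)$. A rule is uniformly good if for all $C$ and all $\alpha>0$, $\mathsf E_C\{T_{inf}(t)\}=o(t^\alpha)$. Conventions: $\inf\emptyset=\infty$, $1/\infty=0$. *)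

(* Defs.v *)
From HB Require Import structures.
From mathcomp Require Import all_boot all_order all_algebra.
From mathcomp Require Import all_classical all_reals all_analysis.

Set Implicit Arguments.
Unset Strict Implicit.
Unset Printing Implicit Defensive.

Import Order.TTheory GRing.Theory Num.Theory.
Local Open Scope classical_set_scope.
Local Open Scope ring_scope.

Definition KL (R : realType) (P Q : probability R R) : \bar R :=
  if pselect (P `<< Q)
  then (\int[P]_y (ln (fine (Radon_Nikodym (charge_of_finite_measure P) Q y)))%:E)%E
  else +oo%E.

Definition mean (R : realType) (P : probability R R) : \bar R :=
  (\int[P]_y (y%:E))%E.

(* 1/K with the conventions 1/+oo = 0 (K is positive here) *)
Definition einv (R : realType) (k : \bar R) : \bar R :=
  match k with
  | r%:E => (r^-1)%:E
  | _ => 0%E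
  end.

Definition arm (R : realType) (C : R * R) (b : bool) : R :=
  if b then C.2 else C.1.

Definition inferior (R : realType) (F : R -> R -> probability R R)
  (C : R * R) (x : R) (b : bool) : bool :=
  (mean (F (arm C b) x) < mean (F (arm C (~~ b)) x))%E.

(* An allocation rule: phi h x = arm chosen at time t = size h + 1, given the
   past observed history h = [(X_1,Y_1); ...; (X_{t-1},Y_{t-1})] (Y_tau being
   the reward of the arm played at tau) and the current covariate x = X_t. *)
Definition rule (R : realType) := seq (R * R) -> R -> bool.

Fixpoint tinf_aux (R : realType) (F : R -> R -> probability R R)
  (phi : rule R) (C : R * R) (past rest : seq (R * R)) : nat :=
  match rest with
  | [::] => 0%N
  | (x, y) :: r =>
      (inferior F C x (phi past x) + tinf_aux F phi C (rcons past (x, y)) r)%N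
  end.

(* Expectation, under configuration C, of g(history after n more steps)
   starting from history h: X ~ G, then Y ~ F_{theta_{phi(h,X)}}(. | X). *)
Fixpoint Eh (R : realType) (Xs : set R) (G : probability R R)
  (F : R -> R -> probability R R) (phi : rule R) (C : R * R)
  (n : nat) (g : seq (R * R) -> \bar R) (h : seq (R * R)) : \bar R :=
  match n with
  | 0%N => g h
  | n'.+1 => (\sum_(x \in Xs)
      (G [set x] * \int[F (arm C (phi h x)) x]_y
                      Eh Xs G F phi C n' g (rcons h (x, y))))%E
  end.

Definition ETinf (R : realType) (Xs : set R) (G : probability R R)
  (F : R -> R -> probability R R) (phi : rule R) (C : R * R) (t : nat) : \bar R :=
  Eh Xs G F phi C t (fun h => ((tinf_aux F phi C [::] h)%:R)%:E) [::].

(* Borel sigma-algebra on R^n (sequences of length n) generated by rectangles *)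
Definition cyl (R : realType) (n : nat) : set (set (seq R)) :=
  [set B | exists A : nat -> set R, (forall i, measurable (A i)) /\
     B = [set ys : seq R | size ys = n /\ forall i, (i < n)%N -> A i (nth 0 ys i)]].

Definition rule_measurable (R : realType) (phi : rule R) : Prop :=
  forall (n : nat) (xs : seq R) (x : R), size xs = n ->
    <<s [set ys : seq R | size ys = n], @cyl R n >>
      [set ys : seq R | size ys = n /\ phi (zip xs ys) x].

Definition uniformly_good (R : realType) (Theta Xs : set R) (G : probability R R)
  (F : R -> R -> probability R R) (phi : rule R) : Prop :=
  forall C : R * R, Theta C.1 -> Theta C.2 ->
  forall a : R, 0 < a -> forall e : R, 0 < e ->
  exists N : nat, forall t : nat, (N <= t)%N ->
    (ETinf Xs G F phi C t <= (e * (t%:R `^ a))%:E)%E.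

Definition infsup (R : realType) (Theta Xs : set R)
  (F : R -> R -> probability R R) (a b : R) : \bar R :=
  ereal_inf [set ereal_sup [set KL (F a x) (F th x) | x in Xs]
            | th in [set th | Theta th /\ b < th]].

Definition supinf (R : realType) (Theta Xs : set R)
  (F : R -> R -> probability R R) (a b : R) : \bar R :=
  ereal_sup [set ereal_inf [set KL (F a x) (F th x)
                           | th in [set th | Theta th /\ b < th]]
            | x in Xs].

Definition Kconst (R : realType) (Theta Xs : set R)
  (F : R -> R -> probability R R) (C : R * R) : \bar R :=
  if C.1 < C.2 then infsup Theta Xs F C.1 C.2 else infsup Theta Xs F C.2 C.1.

(* Main.v *)
Require Import Defs.
From HB Require Import structures.
From mathcomp Require Import all_boot all_order all_algebra.
From mathcomp Require Import all_classical all_reals all_analysis.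
From mathcomp Require Import measurable_realfun ring lra.
Import Order.TTheory GRing.Theory Num.Theory.
Import numFieldNormedType.Exports.

Set Implicit Arguments.
Unset Strict Implicit.
Unset Printing Implicit Defensive.

Local Open Scope classical_set_scope.
Local Open Scope ring_scope.

(** All laws [F th x] ([th] in Theta) are mutually absolutely continuous, so for each arm
    one can form the likelihood of every parameter and its maximiser. The rule calls leader
    the arm with the larger estimate and plays it, except that it plays the other arm [o]
    when (i) some parameter above the leader's estimate has, for the data of [o], a
    likelihood within a factor [threshold t ~ t (ln t)^2] of the maximum, (ii) the covariate
    is the point [xstar] realising the max-min of the Kullback-Leibler numbers for the
    current estimates, and (iii) [o] has not been played more often than the leader.

    The regret is bounded by a supermartingale argument: a nonnegative potential, a sum of
    powers of likelihood ratios, decreases in conditional mean by at least the number of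
    inferior plays. Write [a < b] for the true parameters. Ratios [(f_th / f_a)^s] contract
    in mean under [F a], so plays made with a wrong estimate cost O(1); wrong rejections
    cost O(1) because ratios have mean at most 1 and [1 / threshold] is summable. With both
    estimates correct, [V = sum_{th > b} (M * ratio_th)^s] exceeds 1 at every inferior play
    and contracts by [1 - s K'] there, for any [K' < K] and [s] small, since
    [E (f_th / f_a)^s = 1 - s KL + o(s)]; the concave potential [(1 + ln V) / (s K')] then
    charges [ln M / K' + O(1)] inferior plays, which is the optimal constant. *)

(** * Powers of likelihood ratios and densities *)

(** Weighted arithmetic-geometric mean inequality: with [m = v ^ l], the exponential bounds for
    [v / m] and [1 / m] are averaged with weights [l] and [1 - l], and the logarithms cancel. *)
Lemma powR_le_affine (R : realType) (v l : R) :
  0 < v -> 0 <= l <= 1 -> v `^ l <= 1 - l + l * v.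
Proof.
move=> v0 /andP[l0 l1].
have m0 : 0 < v `^ l by exact: powR_gt0.
have lnm : ln (v `^ l) = l * ln v by rewrite ln_powR.
set m := v `^ l in m0 lnm *.
have H1 : m * (1 + (ln v - ln m)) <= v.
  have vE : v = m * expR (ln v - ln m).
    by rewrite expRB !lnK ?posrE// mulrC divfK// gt_eqF.
  by rewrite [leRHS]vE ler_pM2l// expR_ge1Dx.
have H2 : m * (1 - ln m) <= 1.
  have E1 : 1 = m * expR (- ln m) :> R by rewrite expRN lnK ?posrE// mulfV// gt_eqF.
  by rewrite [leRHS]E1 ler_pM2l// expR_ge1Dx.
have : l * (m * (1 + (ln v - ln m))) <= l * v by exact: ler_wpM2l.
have : (1 - l) * (m * (1 - ln m)) <= 1 - l.
  by rewrite -[leRHS]mulr1; apply: ler_wpM2l => //; rewrite subr_ge0.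
have -> : ln v - ln m = (1-l) * ln v by rewrite lnm; ring.
rewrite lnm => A B.
have : (1 - l) * (m * (1 - l * ln v)) + l * (m * (1 + (1 - l) * ln v)) = m by ring.
lra.
Qed.

(* Tangent line of the exponential, read backwards: lower bound converging to [- ln v]. *)
Lemma oneB_powR_ge (R : realType) (v s : R) :
  0 < v -> 0 < s -> - ln v * v `^ s <= (1 - v `^ s) / s.
Proof.
move=> v0 s0; rewrite ler_pdivlMr//.
have m0 : 0 < v `^ s by exact: powR_gt0.
have H2 : v `^ s * (1 - ln (v `^ s)) <= 1.
  have E1 : 1 = v `^ s * expR (- ln (v `^ s)) :> R.
    by rewrite expRN lnK ?posrE// mulfV// gt_eqF.
  by rewrite [leRHS]E1 ler_pM2l// expR_ge1Dx.
by move: H2; rewrite ln_powR; lra.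
Qed.

(** The integral of a nonnegative function is a supremum over the simple functions below it, so
    monotonicity extends to functions of the history built from the rule. *)
Lemma le_integral_nonneg (R : realType) d (T : measurableType d)
  (mu : {measure set T -> \bar R}) (f g : T -> \bar R) :
  (forall x, 0 <= f x)%E -> (forall x, f x <= g x)%E ->
  (\int[mu]_x f x <= \int[mu]_x g x)%E.
Proof.
move=> f0 fg.
have g0 x : (0 <= g x)%E by exact: le_trans (fg x).
rewrite !ge0_integralTE//; apply: le_ereal_sup => _ [h /= hf <-].
by exists h => // x; exact: le_trans (fg x).
Qed.

Section small_powers.
Context {R : realType} {d} {T : measurableType d} (P : probability T R) (u : T -> R).
Hypothesis u0 : forall y, 0 < u y.
Hypothesis mu : measurable_fun setT u.
Hypothesis intu : (\int[P]_y (u y)%:E <= 1)%E.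

Lemma measurable_powR_comp s : measurable_fun setT (fun y => u y `^ s).
Proof. exact: (measurableT_comp (@measurable_powR R s) mu). Qed.

Lemma integrable_ratio : P.-integrable setT (fun y => (u y)%:E).
Proof.
apply/integrableP; split; first exact/measurable_EFinP.
under eq_integral do rewrite /= gtr0_norm//.
by rewrite (le_lt_trans intu)// ltry.
Qed.

(** Interpolation between the exponents [0] and [r], by [powR_le_affine] at [u y ^ r]. *)
Lemma integral_powR_le (s c r : R) : 0 <= s <= 1 -> 0 <= c ->
  (\int[P]_y (u y `^ r)%:E <= c%:E)%E ->
  (\int[P]_y (u y `^ (s * r))%:E <= (1 - s + s * c)%:E)%E.
Proof.
move=> s01 c0 h; have /andP[s0 s1] := s01.
apply: (@le_trans _ _ (\int[P]_y ((1 - s)%:E + s%:E * (u y `^ r)%:E))%E).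
  apply: le_integral_nonneg => y; first by rewrite lee_fin powR_ge0.
  rewrite -EFinM -EFinD lee_fin mulrC powRrM; apply: powR_le_affine => //.
  exact: powR_gt0.
have ms := measurable_powR_comp r.
rewrite ge0_integralD//=; first last.
- by apply/measurable_EFinP; exact: measurable_funM.
- by move=> y _; rewrite lee_fin mulr_ge0// powR_ge0.
- by move=> y _; rewrite lee_fin subr_ge0.
rewrite ge0_integralZl//=; first last.
- by move=> y _; rewrite lee_fin powR_ge0.
- exact/measurable_EFinP.
rewrite integral_cst// [X in (_ * X)%E]probability_setT mule1 [leRHS]EFinD
  leeD2l// EFinM lee_wpmul2l//.
Qed.

Lemma integral_powR_le1 (s : R) : 0 <= s <= 1 -> (\int[P]_y (u y `^ s)%:E <= 1)%E.
Proof.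
move=> s01; rewrite -[s]mulr1.
apply: le_trans (@integral_powR_le s 1 1 s01 _ _) _ => //.
  by under eq_integral do rewrite powRr1 ?ltW//.
by rewrite lee_fin mulr1 subrK.
Qed.

(** One half of the fact that the mean of [u ^ s] has derivative [- I] at [s = 0]. Fatou's lemma
    along [s = 1 / (n + 1)] yields one good exponent, and interpolation passes to the smaller
    ones. *)
Lemma integral_powR_small (I eps : R) : 0 < eps ->
  (\int[P]_y (- ln (u y))%:E = I%:E)%E ->
  exists2 s0 : R, 0 < s0 <= 1 & forall s, 0 < s <= s0 ->
   (\int[P]_y (u y `^ s)%:E <= (1 - s * (I - eps))%:E)%E.
Proof.
move=> eps0 HI.
pose sn (n : nat) : R := n.+1%:R^-1.
have sn0 n : 0 < sn n by rewrite invr_gt0.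
have sn1 n : sn n <= 1 by rewrite invf_le1// ler1n.
(* Adding [u y - 1] makes the difference quotient nonnegative, as Fatou's lemma requires; the
   integral [c] of this term is the same for all [n] and cancels at the end. *)
pose g n y : \bar R := ((1 - u y `^ sn n) / sn n + (u y - 1))%:E.
have mpow s := measurable_powR_comp s.
have g0 n y : (0 <= g n y)%E.
  rewrite lee_fin -lerBlDr sub0r opprB ler_pdivlMr//.
  have := @powR_le_affine R (u y) (sn n) (u0 y).
  by rewrite sn1 ltW// => /(_ isT); lra.
have mg n : measurable_fun setT (g n).
  apply/measurable_EFinP; apply: measurable_funD; last first.
    by apply: measurable_funB.
  by apply: measurable_funM => //; apply: measurable_funB.
have intpow s : 0 <= s <= 1 -> P.-integrable setT (fun y => (u y `^ s)%:E).
  move=> s01; apply/integrableP; split; first exact/measurable_EFinP.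
  under eq_integral do rewrite /= ger0_norm ?powR_ge0//.
  by rewrite (le_lt_trans (integral_powR_le1 s01))// ltry.
have mln : measurable_fun setT (fun y => - ln (u y)).
  by apply: measurable_funN; exact: (measurableT_comp (@measurable_ln R) mu).
have negfin : (\int[P]_y ((fun y => (- ln (u y))%:E) ^\- y) < +oo)%E.
  apply: (@le_lt_trans _ _ (\int[P]_y (u y)%:E)%E); last by rewrite (le_lt_trans intu)// ltry.
  apply: le_integral_nonneg => y.
    exact: funeneg_ge0.
  rewrite funenegE /= opprK ge_max; apply/andP; split.
    by rewrite lee_fin ltW// ln_sublinear.
  by rewrite lee_fin ltW.
(* The negative part is dominated by [u]; the finite total [I] then forces the positive part to be
   integrable. *)
have intln : P.-integrable setT (fun y => (- ln (u y))%:E).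
  apply/integrableP; split; first exact/measurable_EFinP.
  rewrite (_ : (fun x => `|(- ln (u x))%:E|%E) = abse \o (fun y => (- ln (u y))%:E))//.
  rewrite fune_abse ge0_integralD//; first last.
  - by apply: measurable_funeneg; exact/measurable_EFinP.
  - by apply: measurable_funepos; exact/measurable_EFinP.
  rewrite lte_add_pinfty//.
  have HI' := HI; rewrite integralE in HI'.
  have : (0 <= \int[P]_y ((fun y => (- ln (u y))%:E) ^\- y))%E by exact: integral_ge0.
  move: negfin HI'; set A := integral _ _ _; set B := integral _ _ _.
  by case: A => // a; case: B => // b _ _; rewrite ltry.
have fpow n : (\int[P]_y (u y `^ sn n)%:E)%E \is a fin_num.
  by apply: integrable_fin_num => //; apply: intpow; rewrite sn1 ltW.
have intu1 : P.-integrable setT (fun y => (u y - 1)%:E).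
  by under eq_fun do rewrite EFinB; apply: integrableB => //;
    [exact: integrable_ratio|exact: finite_measure_integrable_cst].
have Eu1 : (\int[P]_y (u y - 1)%:E = (fine (\int[P]_y (u y)%:E) - 1)%:E)%E.
  under eq_integral do rewrite EFinB.
  rewrite integralB_EFin//; [|exact: integrable_ratio|exact: finite_measure_integrable_cst].
  rewrite integral_cst// [X in (_ * X)%E]probability_setT mule1 EFinB fineK//.
  by apply: integrable_fin_num => //; exact: integrable_ratio.
set c := (fine _ - 1) in Eu1.
have intg n : (\int[P]_y g n y = ((1 - fine (\int[P]_y (u y `^ sn n)%:E)) / sn n + c)%:E)%E.
  have i1 : P.-integrable setT (fun y => (1 - u y `^ sn n)%:E).
    by under eq_fun do rewrite EFinB; apply: integrableB => //;
      [exact: finite_measure_integrable_cst|apply: intpow; rewrite sn1 ltW].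
  have i2 : P.-integrable setT (fun y => ((1 - u y `^ sn n) / sn n)%:E).
    under eq_fun do rewrite mulrC EFinM.
    exact: integrableZl.
  under eq_integral do rewrite /g EFinD.
  rewrite integralD// Eu1 [in RHS]EFinD; congr (_ + _)%E.
  under eq_integral do rewrite mulrC EFinM.
  rewrite integralZl// mulrC EFinM; congr (_ * _)%E.
  under eq_integral do rewrite EFinB.
  rewrite integralB_EFin//; [|exact: finite_measure_integrable_cst|
    by apply: intpow; rewrite sn1 ltW].
  by rewrite integral_cst// [X in (_ * X)%E]probability_setT mule1 EFinB fineK.
have lim : (\int[P]_y limn_einf (g^~ y) = (I + c)%:E)%E.
  transitivity (\int[P]_y ((- ln (u y))%:E + (u y - 1)%:E))%E; last first.
    by rewrite integralD// Eu1 HI.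
  apply: eq_integral => y _.
  have cvpow : u y `^ sn n @[n --> \oo] --> (1 : R).
    rewrite -[X in _ --> X](@expR0 R)
      (_ : (fun n => _) = (fun n => expR (sn n * ln (u y)))); last first.
      by apply/funext => n; rewrite /powR gt_eqF.
    apply: (@cvg_comp _ _ _ (fun n => sn n * ln (u y)) expR _ (nbhs (0 : R))).
      have : sn n * ln (u y) @[n --> \oo] --> 0 * ln (u y).
        by apply: cvgMl; exact: cvg_harmonic.
      by rewrite mul0r.
    exact: continuous_expR.
  have cv : (1 - u y `^ sn n) / sn n @[n --> \oo] --> - ln (u y).
    apply: (@squeeze_cvgr _ _ _ _ (fun n => - ln (u y) * u y `^ sn n) (fun=> - ln (u y))).
    - near=> n; rewrite oneB_powR_ge//= ler_pdivrMr// mulNr lerBlDl.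
      rewrite -[_ `^ _](@lnK R) ?posrE ?powR_gt0// ln_powR mulrC.
      by rewrite -lerBlDr opprK addrC; apply: le_trans (expR_ge1Dx _); rewrite addrC.
    - rewrite -[X in _ --> X]mulr1; apply: cvgMr; exact: cvpow.
    - exact: cvg_cst.
  have /cvg_limn_einf_sup[-> _] : g ^~ y @ \oo --> (- ln (u y) + (u y - 1))%:E.
    by apply: cvg_EFin; [near=> n|apply: cvgD => //; exact: cvg_cst].
  by [].
(* If every exponent failed, the integrals of [g n] would stay below [I + c - eps], against Fatou's
   lower bound [I + c]. *)
have [n Hn] : exists n, (\int[P]_y (u y `^ sn n)%:E <= (1 - sn n * (I - eps))%:E)%E.
  apply: contrapT => /forallNP H.
  have : (\int[P]_y limn_einf (g^~ y) <= (I + c - eps)%:E)%E.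
    apply: (le_trans (fatou P measurableT mg (fun n x _ => g0 n x))).
    rewrite limn_einf_lim; apply: lime_le; first exact: is_cvg_einfs.
    near=> n; apply: (@le_trans _ _ (\int[P]_y g n y)%E).
      by apply: ereal_inf_lbound; exists n => //=.
    rewrite intg lee_fin [leRHS]addrAC lerD2r ler_pdivrMr//.
    have /negP := H n; rewrite -ltNge -[X in (_ < X)%E](fineK (fpow n)) lte_fin.
    set z := fine _; lra.
  rewrite lim lee_fin; lra.
exists (sn n); first by rewrite sn0 sn1.
move=> s /andP[s0 ss].
rewrite -[s in X in (X <= _)%E](@divfK _ (sn n))// ?gt_eqF//.
have sn01 : 0 <= s / sn n <= 1.
  by rewrite divr_ge0 ?(ltW s0) ?(ltW (sn0 _))//= ler_pdivrMr// mul1r.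
apply: le_trans (@integral_powR_le (s / sn n) _ _ sn01 _ Hn) _.
  rewrite -lee_fin; apply: le_trans Hn; apply: integral_ge0 => y _.
  by rewrite lee_fin powR_ge0.
rewrite lee_fin le_eqVlt; apply/orP; left; apply/eqP.
by field; rewrite gt_eqF.
Unshelve. all: by end_near. Qed.
End small_powers.

(** * Everywhere positive densities with respect to one reference law *)

Lemma measurable_fun_ratio (R : realType) d (T : measurableType d) (f g : T -> R) :
  measurable_fun setT f -> measurable_fun setT g -> (forall y, 0 < g y) ->
  measurable_fun setT (fun y => f y / g y).
Proof.
move=> mf mg g0; apply: measurable_funM => //.
under eq_fun do rewrite -powR_inv1 ?ltW//.
exact: (measurableT_comp (measurable_powR _) mg).
Qed.

(** Densities are taken with respect to one member of the family and replaced by [1] where they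
    vanish. Mutual absolute continuity makes that set null, so the Kullback-Leibler numbers are
    unchanged. *)
Lemma exists_densities (R : realType) (Theta : set R) (F : R -> probability R R) :
  (forall a b, Theta a -> Theta b -> F a `<< F b) ->
  exists f : R -> R -> R,
  [/\ forall th, measurable_fun setT (f th),
      forall th y, 0 < f th y,
      forall a th, Theta a -> Theta th -> (\int[F a]_y (f th y / f a y)%:E <= 1)%E &
      forall a th, Theta a -> Theta th ->
        KL (F a) (F th) = (\int[F a]_y (- ln (f th y / f a y))%:E)%E].
Proof.
move=> dom.
have [[th0 T0]|nT] := pselect (exists th, Theta th); last first.
  by exists (fun _ _ => 1); split => // a th Ta; exfalso; apply: nT; exists a.
pose P0 := F th0.
pose RN a := Radon_Nikodym_SigmaFinite.f (F a) P0.
pose D a y := fine (RN a y).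
pose f a y := if pselect (Theta a) then (if 0 < D a y then D a y else 1) else 1.
have RNE a y : Theta a -> RN a y = (D a y)%:E.
  by move=> Ta; rewrite /D fineK// Radon_Nikodym_SigmaFinite.f_fin_num//; exact: dom.
have D0 a y : Theta a -> 0 <= D a y.
  by move=> Ta; rewrite -lee_fin -RNE//; apply: Radon_Nikodym_SigmaFinite.f_ge0; exact: dom.
have mRN a : Theta a -> measurable_fun setT (RN a).
  move=> Ta; 
  have /integrableP[] // := @Radon_Nikodym_SigmaFinite.f_integrable _ _ _ (F a) P0 (dom _ _ Ta T0).
have mD a : Theta a -> measurable_fun setT (D a).
  by move=> Ta; apply: measurableT_comp (mRN a Ta); exact: fine_measurable.
have mDpos a : Theta a -> measurable [set y | 0 < D a y].
  move=> Ta; rewrite -[X in measurable X]setTI.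
  rewrite (_ : [set y | 0 < D a y] = D a @^-1` `]0, +oo[%classic).
    by apply: mD => //; exact: measurable_itv.
  by apply/seteqP; split => y /=; rewrite in_itv/= andbT.
have fpos a y : 0 < f a y.
  by rewrite /f; case: pselect => // Ta; case: ifPn.
have mf a : measurable_fun setT (f a).
  rewrite /f; case: pselect => //= Ta.
  apply: measurable_fun_ifT => //; last exact: mD.
  by apply: measurable_fun_ltr => //; exact: mD.
have Df a y : Theta a -> D a y <= f a y.
  move=> Ta; rewrite /f; case: pselect => //= ?.
  by case: ifPn => //; rewrite -leNgt => /le_trans; apply.
(* [F a] has no mass where its own density vanishes, and it dominates [P0]. *)
have nullD a : Theta a -> P0 (~` [set y | 0 < D a y]) = 0%E.
  move=> Ta; have /null_content_dominatesP := dom _ _ T0 Ta.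
  apply; first by apply: measurableC; exact: mDpos.
  have /= -> := @Radon_Nikodym_SigmaFinite.f_integral _ _ _ (F a) P0 (dom _ _ Ta T0)
    _ (measurableC (mDpos _ Ta)).
  rewrite -/(RN a).
  under eq_integral.
    move=> y; rewrite inE/= => /negP; rewrite -leNgt => Dy.
    rewrite (RNE a y Ta) (_ : D a y = 0); last by apply/eqP; rewrite eq_le Dy D0.
    over.
  by rewrite integral0.
have fDae a : Theta a -> ae_eq P0 setT (f a) (D a).
  move=> Ta; exists (~` [set y | 0 < D a y]); split.
  - by apply: measurableC; exact: mDpos.
  - exact: nullD.
  - move=> y /= nfD Dy; apply: nfD => _.
    by rewrite /f; case: pselect => //= ?; rewrite Dy.
have cov a (h : R -> \bar R) : Theta a -> measurable_fun setT h -> (forall y, 0 <= h y)%E ->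
    (\int[F a]_y h y = \int[P0]_y (h y * (D a y)%:E))%E.
  move=> Ta mh h0.
  rewrite -(@Radon_Nikodym_SigmaFinite.change_of_variables _ _ _ (F a) P0)//; last exact: dom.
  by apply: eq_integral => y _; rewrite -RNE.
exists f; split => //.
  move=> a th Ta Tth; rewrite cov//; first last.
  - by move=> y; rewrite lee_fin divr_ge0// ltW.
  - by apply/measurable_EFinP; exact: measurable_fun_ratio.
  (* Since [D a <= f a], passing to [P0] absorbs the denominator and leaves the total mass of
     [F th]. *)
  apply: (@le_trans _ _ (\int[P0]_y (f th y)%:E)%E).
    apply: le_integral_nonneg => y.
      by rewrite -EFinM lee_fin mulr_ge0 ?D0// divr_ge0// ltW.
    rewrite -EFinM lee_fin -mulrA ger_pMr// mulrC ler_pdivrMr// mul1r.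
    exact: Df.
  rewrite (@ae_eq_integral _ _ _ _ _ (RN th))//; first last.
  - have := fDae _ Tth; apply: filterS => y H /H; rewrite (RNE _ _ Tth) => ->; done.
  - exact: mRN.
  - exact/measurable_EFinP.
  have /= <- := @Radon_Nikodym_SigmaFinite.f_integral _ _ _ (F th) P0
    (dom _ _ Tth T0) _ measurableT.
  by rewrite [leLHS]probability_setT.
move=> a th Ta Tth; rewrite /KL; case: pselect => [Fath|nd]; last by case: nd; exact: dom.
apply: ae_eq_integral => //.
- apply/measurable_EFinP; apply: (measurableT_comp (@measurable_ln R)).
  apply: (measurableT_comp (fine_measurable measurableT)).
  by have /integrableP[] :=
    @Radon_Nikodym_integrable _ _ _ (charge_of_finite_measure (F a)) (F th) Fath.
- apply/measurable_EFinP; apply: measurable_funN; apply: (measurableT_comp (@measurable_ln R)).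
  exact: measurable_fun_ratio.
(* The chain rule through [P0] identifies the derivative of [F a] with respect to [F th] as
   [f a / f th], off a set that is null for [P0], hence for [F a]. *)
- apply: (@null_dominates_ae_eq _ _ _ _ (F a) P0) => //; first exact: dom.
  have aeSF b Tb :=
    @ae_eq_Radon_Nikodym_SigmaFinite _ _ _ (F b) P0 (dom _ _ Tb T0) setT measurableT.
  have /= ch :=
    @Radon_Nikodym_chain_rule _ _ _ (charge_of_finite_measure (F a)) P0
      (F th) Fath (dom _ _ Tth T0).
  have H1 := fDae _ Ta; have H2 := fDae _ Tth.
  have H3 := aeSF _ Ta; have H4 := aeSF _ Tth.
  move: H1; apply: filter_app; move: H2; apply: filter_app; move: H3; apply: filter_app.
  move: H4; apply: filter_app; move: ch; apply: filterS => y H5 H4 H3 H2 H1 _.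
  move: (H5 Logic.I); rewrite /= -(H3 Logic.I) -(H4 Logic.I) -/(RN a) -/(RN th) !RNE// => E.
  have fin := @Radon_Nikodym_fin_num _ _ _ (charge_of_finite_measure (F a)) (F th) y Fath.
  congr (_%:E); rewrite -lnV ?posrE ?divr_gt0// invf_div; congr ln.
  rewrite H1// H2//; move: E; rewrite -(fineK fin) => -[->].
  by rewrite -H2// mulfK// gt_eqF.
Qed.

(** * Potentials bounding the regret *)

(* A bound on the mean of [g] through a measurable majorant: [g] itself, typically a
   function of the history involving the rule, is never shown to be measurable. *)
Definition upper_mean (R : realType) (P : probability R R) (g : R -> R) (c : R) :=
  exists w : R -> R, [/\ measurable_fun setT w, forall y, 0 <= w y,
    forall y, g y <= w y & (\int[P]_y (w y)%:E <= c%:E)%E].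

Section upper_mean_lemmas.
Context {R : realType} (P : probability R R).
Implicit Types (g : R -> R) (c k : R).

Lemma upper_mean_self g c : measurable_fun setT g -> (forall y, 0 <= g y) ->
  (\int[P]_y (g y)%:E <= c%:E)%E -> upper_mean P g c.
Proof. by move=> mg g0 gc; exists g. Qed.

Lemma upper_mean_cst k : 0 <= k -> upper_mean P (fun=> k) k.
Proof.
move=> k0; exists (fun=> k); split => //.
by rewrite integral_cst// [X in (_ * X)%E]probability_setT mule1.
Qed.

Lemma upper_mean_le g g' c c' : (forall y, g' y <= g y) -> c <= c' ->
  upper_mean P g c -> upper_mean P g' c'.
Proof.
move=> gg cc [w [mw w0 gw wc]]; exists w; split => //.
- by move=> y; exact: le_trans (gw y).
- by rewrite (le_trans wc)// lee_fin.
Qed.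

Lemma upper_mean_add g1 g2 c1 c2 : upper_mean P g1 c1 -> upper_mean P g2 c2 ->
  upper_mean P (fun y => g1 y + g2 y) (c1 + c2).
Proof.
move=> [w [mw w0 gw wc]] [v [mv v0 gv vc]]; exists (fun y => w y + v y); split => //.
- exact: measurable_funD.
- by move=> y; exact: addr_ge0.
- by move=> y; exact: lerD.
- under eq_integral do rewrite EFinD.
  rewrite ge0_integralD//=; first by rewrite EFinD leeD.
  + by move=> y _; rewrite lee_fin.
  + exact/measurable_EFinP.
  + by move=> y _; rewrite lee_fin.
  + exact/measurable_EFinP.
Qed.

Lemma upper_mean_scale k g c : 0 <= k -> upper_mean P g c ->
  upper_mean P (fun y => k * g y) (k * c).
Proof.
move=> k0 [w [mw w0 gw wc]]; exists (fun y => k * w y); split => //.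
- exact: measurable_funM.
- by move=> y; exact: mulr_ge0.
- by move=> y; exact: ler_wpM2l.
- under eq_integral do rewrite EFinM.
  rewrite ge0_integralZl//=; first by rewrite [leRHS]EFinM lee_wpmul2l.
  + exact/measurable_EFinP.
  + by move=> y _; rewrite lee_fin.
Qed.

Lemma upper_mean_sum (I : eqType) (r : seq I) (g : I -> R -> R) (c : I -> R) :
  (forall i, i \in r -> upper_mean P (g i) (c i)) ->
  upper_mean P (fun y => \sum_(i <- r) g i y) (\sum_(i <- r) c i).
Proof.
elim: r => [|i r IH] H.
  rewrite big_nil; apply: upper_mean_le (upper_mean_cst (lexx 0)) => // y.
  by rewrite big_nil.
rewrite big_cons; apply: (@upper_mean_le (fun y => g i y + \sum_(j <- r) g j y)) => //.
  by move=> y; rewrite big_cons.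
apply: upper_mean_add; first by apply: H; rewrite mem_head.
by apply: IH => j jr; apply: H; rewrite inE jr orbT.
Qed.

Lemma upper_mean_integral (g : R -> \bar R) (g' : R -> R) c :
  (forall y, 0 <= g y)%E -> (forall y, g y <= (g' y)%:E)%E ->
  upper_mean P g' c -> (\int[P]_y g y <= c%:E)%E.
Proof.
move=> g0 gg [w [mw w0 gw wc]]; apply: le_trans wc; apply: le_integral_nonneg => // y.
by rewrite (le_trans (gg y))// lee_fin.
Qed.

End upper_mean_lemmas.

Section potential.
Context {R : realType} (xs : seq R) (G : probability R R)
  (F : R -> R -> probability R R) (phi : rule R) (C : R * R).
Hypothesis uniq_xs : uniq xs.

Lemma tinf_aux_rcons past h x y : tinf_aux F phi C past (rcons h (x, y)) =
  (tinf_aux F phi C past h + inferior F C x (phi (past ++ h) x))%N.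
Proof.
elim: h past => [|[x' y'] h IH] past /=; first by rewrite cats0 addn0 add0n.
by rewrite IH addnA cat_rcons.
Qed.

Let g h : \bar R := ((tinf_aux F phi C [::] h)%:R)%:E.

Lemma Eh_ge0 n h : (0 <= Eh [set` xs] G F phi C n g h)%E.
Proof.
elim: n h => [|n IH] h /=; first by rewrite lee_fin.
apply: fsume_ge0 => x _; apply: mule_ge0 => //.
by apply: integral_ge0 => y _; exact: IH.
Qed.

(** Induction on the number of remaining steps: the count of inferior plays plus [Phi] is a
    supermartingale up to the horizon [T]. The horizon is explicit because the potential used later
    depends on it. *)
Lemma Eh_potential (T : nat) (Phi : seq (R * R) -> R) :
  (forall h, 0 <= Phi h) ->
  (forall h, (size h < T)%N -> exists2 c : R -> R,
    (forall x, x \in xs ->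
      upper_mean (F (arm C (phi h x)) x) (fun y => Phi (rcons h (x, y))) (c x)) &
    \sum_(x <- xs) fine (G [set x]) * ((inferior F C x (phi h x))%:R + c x)
      <= Phi h) ->
  \sum_(x <- xs) fine (G [set x]) = 1 ->
  forall n h, (size h + n <= T)%N ->
  (Eh [set` xs] G F phi C n g h <= ((tinf_aux F phi C [::] h)%:R + Phi h)%:E)%E.
Proof.
move=> Phi0 drift G1; elim => [|n IH] h sh /=.
  by rewrite lee_fin lerDl.
have [|c cP sumc] := drift h; first by rewrite (leq_trans _ sh)// addnS ltnS leq_addr.
set t := (tinf_aux F phi C [::] h)%:R : R.
rewrite -fsbig_seq//=.
apply: (@le_trans _ _ (\sum_(x <- xs)
   (fine (G [set x]) * (t + (inferior F C x (phi h x))%:R + c x))%:E)%E).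
  rewrite big_seq [leRHS]big_seq; apply: lee_sum => x xX.
  rewrite EFinM fineK ?fin_num_measure//.
  apply: lee_wpmul2l => //.
  apply: upper_mean_integral; last first.
  - apply: upper_mean_add; last exact: cP.
    by apply: upper_mean_cst; rewrite addr_ge0.
  - move=> y /=; have := IH (rcons h (x, y)).
    rewrite size_rcons -addSnnS in sh * => /(_ sh) /le_trans; apply.
    by rewrite tinf_aux_rcons natrD.
  - by move=> y; exact: Eh_ge0.
rewrite sumEFin lee_fin.
under eq_bigr do rewrite -addrA mulrDr.
by rewrite big_split/= -mulr_suml G1 mul1r lerD2l.
Qed.

End potential.

(** * The allocation rule *)

Lemma exists_argmax d (O : orderType d) (T : eqType) (g : T -> O) (r : seq T) : r != [::] ->
  exists2 t, t \in r & forall t', t' \in r -> (g t' <= g t)%O.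
Proof.
elim: r => // t [|u r] IH _.
  by exists t => [|t']; rewrite inE// => /eqP ->.
have [m mr mP] := IH isT; have [tm|/ltW mt] := leP (g t) (g m).
  by exists m => [|t']; rewrite inE ?mr ?orbT// => /predU1P[->//|/mP].
exists t => [|t']; rewrite inE ?eqxx// => /predU1P[->//|/mP] /le_trans; exact.
Qed.

Section likelihood_rule.
Context {R : realType} (ths : seq R) (f : R -> R -> R -> R) (xstar : R -> R -> R).

(** The squared logarithm makes the inverses summable, yet [ln (threshold t)] is still [ln t] up to
    lower-order terms, which preserves the leading constant. *)
Definition threshold (t : nat) : R := t.+2%:R * (1 + ln t.+2%:R) ^+ 2.

(** First maximiser, as an index computed from Boolean comparisons. Like the mask [survivors], it
    takes countably many values, so measurability of the rule reduces to that of the comparisons. *)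
Definition argmax_index (g : R -> R) : nat :=
  find id [seq all id [seq g th' <= g th | th' <- ths] | th <- ths].

Definition argmax (g : R -> R) : R := nth 0 ths (argmax_index g).

Definition survivors (k : R) (g : R -> R) : seq bool :=
  [seq all id [seq g th' < k * g th | th' <- ths] | th <- ths].

Definition survivor_above (b : R) (m : seq bool) : bool :=
  has (fun p => p.1 && (b < p.2)) (zip m ths).

(* Number of plays of each arm, and likelihood of each parameter for each arm. *)
Definition stats := ((bool -> nat) * (bool -> R -> R))%type.

(** Separated from the likelihoods, so that the decision is a function of countable data. When the
    estimates tie, arm [false] leads. *)
Definition decide (N e : bool -> nat) (m : bool -> seq bool) (x : R) : bool :=
  let est i := nth 0 ths (e i) in
  let leader := est false < est true in
  if [&& survivor_above (est leader) (m (~~ leader)),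
         x == xstar (est (~~ leader)) (est leader) & (N (~~ leader) <= N leader)%N]
  then ~~ leader else leader.

Definition choose_arm (s : stats) (x : R) : bool :=
  decide s.1 (fun i => argmax_index (s.2 i))
    (fun i => survivors (threshold (s.1 true + s.1 false)) (s.2 i)) x.

Definition update (s : stats) (i : bool) (x y : R) : stats :=
  ((fun j => s.1 j + (j == i))%N,
   fun j th => if j == i then s.2 j th * f th x y else s.2 j th).

Definition stats_of (h : seq (R * R)) : stats :=
  foldl (fun s p => update s (choose_arm s p.1) p.1 p.2) ((fun=> 0%N), (fun _ _ => 1)) h.

Definition likelihood_rule : rule R := fun h x => choose_arm (stats_of h) x.

Lemma stats_of_rcons h x y : stats_of (rcons h (x, y)) =
  update (stats_of h) (likelihood_rule h x) x y.
Proof. by rewrite /stats_of foldl_rcons. Qed.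

Lemma argmax_index_lt (g : R -> R) : ths != [::] -> (argmax_index g < size ths)%N.
Proof.
move=> ths0; rewrite /argmax_index -(size_map (fun th => all id [seq g th' <= g th | th' <- ths])).
rewrite -has_find has_map; apply/hasP.
have [th thin thmax] := exists_argmax g ths0.
exists th => //=; rewrite all_map; apply/allP => th' /=; exact: thmax.
Qed.

Lemma argmax_in g : ths != [::] -> argmax g \in ths.
Proof. by move=> h; apply: mem_nth; exact: argmax_index_lt. Qed.

Lemma argmaxP g th : ths != [::] -> th \in ths -> g th <= g (argmax g).
Proof.
move=> h thin; have lt := argmax_index_lt g h.
have : all id [seq g th' <= g (argmax g) | th' <- ths].
  have := @nth_find _ false id [seq all id [seq g th' <= g th | th' <- ths] | th <- ths].
  rewrite -/(argmax_index g) (nth_map 0)//; apply.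
  by rewrite has_find -/(argmax_index g) size_map.
by rewrite all_map => /allP/(_ _ thin).
Qed.

Lemma survivor_aboveP (k : R) g b : reflect
  (exists th, [/\ th \in ths, b < th & forall th', th' \in ths -> g th' < k * g th])
  (survivor_above b (survivors k g)).
Proof.
rewrite /survivor_above /survivors.
have zip_map (q : R -> bool) r : zip [seq q t | t <- r] r = [seq (q t, t) | t <- r].
  by elim: r => //= t r ->.
rewrite zip_map has_map; apply: (iffP hasP) => [[th thin /= /andP[]]|[th [thin bth H]]].
  rewrite all_map => /allP H bth; exists th; split => //.
exists th => //=; rewrite bth andbT all_map; apply/allP => th'; exact: H.
Qed.

End likelihood_rule.

(** * A concave function, linear up to one and logarithmic beyond *)

Section log_cap.
Context {R : realType}.
Implicit Types v w : R.

(** Concave and continuously differentiable, with derivative [log_cap_slope]. Beyond [1] the slope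
    is [v^-1], so a relative contraction of [v] in mean lowers the mean of [log_cap v] by a fixed
    amount. *)
Definition log_cap v : R := if v <= 1 then v else 1 + ln v.

Definition log_cap_slope v : R := if v <= 1 then 1 else v^-1.

Lemma ln_leB1 v : 0 < v -> ln v <= v - 1.
Proof.
move=> v0; have h : - 1 < v - 1 by lra.
by have := le_ln1Dx h; rewrite (_ : 1 + (v - 1) = v)//; ring.
Qed.

Lemma log_cap_ge0 v : 0 <= v -> 0 <= log_cap v.
Proof.
move=> v0; rewrite /log_cap; case: (leP v 1) => // /ltW v1.
by rewrite addr_ge0// ln_ge0.
Qed.

Lemma log_cap_slope_ge0 v : 0 <= v -> 0 <= log_cap_slope v.
Proof. by move=> v0; rewrite /log_cap_slope; case: ifP => // _; rewrite invr_ge0. Qed.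

(** Concavity: the graph lies below its tangent at [v]. The bound is affine in [w], so it acts as
    Jensen's inequality for [upper_mean]. *)
Lemma log_cap_tangent v w : 0 <= v -> 0 <= w ->
  log_cap w <= (log_cap v - log_cap_slope v * v) + log_cap_slope v * w.
Proof.
move=> v0 w0; rewrite /log_cap_slope /log_cap; case: (leP v 1) => [v1|v1].
  rewrite !mul1r subrr add0r; case: (leP w 1) => // w1.
  by have := @ln_leB1 w; lra.
have vpos : 0 < v by lra.
rewrite mulVf ?gt_eqF//; case: (leP w 1) => w1.
  (* Mixed case: [ln v >= 1 - v^-1 >= w * (1 - v^-1)]. *)
  have : ln v^-1 <= v^-1 - 1 by apply: ln_leB1; rewrite invr_gt0.
  rewrite lnV ?posrE// => h.
  have : 0 <= (1 - v^-1) * (1 - w) by rewrite mulr_ge0// subr_ge0// invf_le1// ltW.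
  lra.
have wpos : 0 < w by lra.
have : ln (w / v) <= w / v - 1 by apply: ln_leB1; rewrite divr_gt0.
by rewrite ln_div ?posrE//; lra.
Qed.

Lemma log_cap_tangent_ge0 v : 0 <= v -> 0 <= log_cap v - log_cap_slope v * v.
Proof.
move=> v0; rewrite /log_cap /log_cap_slope; case: (leP v 1) => v1.
  by rewrite mul1r subrr.
rewrite mulVf ?gt_eqF//; last by lra.
by have := ln_ge0 (ltW v1); lra.
Qed.

Lemma log_cap_slopeM v : 1 <= v -> log_cap_slope v * v = 1.
Proof.
rewrite /log_cap_slope; case: (leP v 1) => [v1 v1'|v1 _].
  by apply/eqP; rewrite mul1r eq_le v1.
by rewrite mulVf// gt_eqF//; lra.
Qed.

Lemma log_cap_le_ln v w : 0 <= v <= w -> 1 <= w -> log_cap v <= 1 + ln w.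
Proof.
move=> /andP[v0 vw] w1; rewrite /log_cap; case: (leP v 1) => v1.
  by have := ln_ge0 w1; lra.
by rewrite lerD2l ler_ln ?posrE//; lra.
Qed.

End log_cap.

(* Telescoping majorant of the sum of the inverses of [threshold]. *)
Definition threshold_tail {R : realType} (t : nat) : R := (1 + ln t.+1%:R)^-1.

Lemma threshold_tail_ge0 (R : realType) t : 0 <= threshold_tail t :> R.
Proof. by rewrite invr_ge0 addr_ge0// ln_ge0// ler1n. Qed.

Lemma threshold_gt0 (R : realType) t : 0 < threshold t :> R.
Proof.
rewrite mulr_gt0// exprn_gt0// ltr_wpDr// ln_ge0// ler1n//.
Qed.

Lemma threshold_le (R : realType) t t' : (t <= t')%N -> threshold t <= threshold t' :> R.
Proof.
move=> tt; apply: ler_pM => //.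
- by rewrite sqr_ge0.
- by rewrite ler_nat !ltnS.
- rewrite ler_sqr ?nnegrE ?addr_ge0 ?ln_ge0 ?ler1n//.
  by rewrite lerD2l ler_ln ?posrE// ler_nat !ltnS.
Qed.

(** [ln (t+2) - ln (t+1) >= 1 / (t+2)], and both denominators are at most [1 + ln (t+2)]. *)
Lemma threshold_tailB (R : realType) t :
  (threshold t)^-1 <= threshold_tail t - threshold_tail t.+1 :> R.
Proof.
rewrite /threshold /threshold_tail.
set p := ln t.+1%:R; set q := ln t.+2%:R.
have p0 : 0 <= p by rewrite ln_ge0// ler1n.
have pq : p <= q by rewrite ler_ln ?posrE// ler_nat.
have qp : t.+2%:R^-1 <= q - p.
  have := @ln_leB1 R (t.+1%:R / t.+2%:R) _; rewrite divr_gt0// => /(_ isT).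
  rewrite ln_div ?posrE// -/p -/q.
  have -> : t.+1%:R / t.+2%:R = 1 - t.+2%:R^-1 :> R.
    have : t.+2%:R != 0 :> R by rewrite pnatr_eq0.
    by rewrite -(natr1 t.+1) => h; field.
  by rewrite addrAC subrr add0r lerNr opprB.
have -> : (1 + p)^-1 - (1 + q)^-1 = (q - p) / ((1 + p) * (1 + q)).
  by field; apply/andP; split; rewrite gt_eqF//; lra.
rewrite invfM; apply: ler_pM => //.
- by rewrite invr_ge0 sqr_ge0.
- rewrite lef_pV2 ?posrE; [|by rewrite exprn_gt0//; lra|by rewrite mulr_gt0//; lra].
  rewrite expr2; apply: ler_pM; lra.
Qed.

(** * Drift of the potential *)

Lemma le_term_sum (R : realType) (I : eqType) (P : pred I) (g : I -> R) (r : seq I) z :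
  (forall y, 0 <= g y) -> z \in r -> P z -> g z <= \sum_(y <- r | P y) g y.
Proof.
by move=> g0 zr Pz; rewrite (big_rem z)//= Pz lerDl; apply: sumr_ge0.
Qed.

Lemma neq_bool_neg (k l : bool) : (k == l) = false -> k = ~~ l.
Proof. by case: k; case: l. Qed.

Lemma ge1_add4 (R : realType) (c1 c2 c3 c4 : R) :
  0 <= c1 -> 0 <= c2 -> 0 <= c3 -> 0 <= c4 ->
  [\/ 1 <= c1, 1 <= c2, 1 <= c3 | 1 <= c4] -> 1 <= c1 + c2 + c3 + c4.
Proof. by move=> ? ? ? ? []; lra. Qed.

Section drift.
Context {R : realType} (ths xs : seq R) (f : R -> R -> R -> R) (xstar : R -> R -> R)
  (F : R -> R -> probability R R) (C : R * R) (i : bool).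
Let j := ~~ i.
Let a := arm C i.
Let b := arm C j.
(** [p] is the law of the covariate. Powers [s] of ratios to the true parameter contract in mean by
    [rho], and by [1 - kappa] at [xstar a b] for arm [i] and parameters above [b]; [s / kappa]
    becomes the leading constant. [M] bounds the thresholds before time [T]. *)
Context (p : R -> R) (pmin s rho kappa M : R) (T : nat).

Hypothesis f_gt0 : forall th x y, 0 < f th x y.
Hypotheses (a_ths : a \in ths) (b_ths : b \in ths) (ab : a < b).
Hypothesis mean_ab : forall x, x \in xs -> (mean (F a x) < mean (F b x))%E.
Hypotheses (pmin_gt0 : 0 < pmin) (p_ge : forall x, x \in xs -> pmin <= p x)
  (p_sum : \sum_(x <- xs) p x = 1) (uniq_xs : uniq xs).
Hypothesis xstar_xs : forall c d, xstar c d \in xs.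
Hypotheses (rho_gt0 : 0 < rho) (rho_lt1 : rho < 1) (kappa_gt0 : 0 < kappa).
Hypothesis power_a : forall x th, x \in xs -> th \in ths -> th != a ->
  upper_mean (F a x) (fun y => (f th x y / f a x y) `^ s) rho.
Hypothesis power_b : forall x th, x \in xs -> th \in ths -> th != b ->
  upper_mean (F b x) (fun y => (f th x y / f b x y) `^ s) rho.
Hypothesis ratio_b : forall x th, x \in xs -> th \in ths ->
  upper_mean (F b x) (fun y => f th x y / f b x y) 1.
Hypothesis power_star : forall th, th \in ths -> b < th ->
  upper_mean (F a (xstar a b)) (fun y => (f th (xstar a b) y / f a (xstar a b) y) `^ s)
    (1 - kappa).
Hypotheses (M_gt0 : 0 < M) (threshold_M : forall t, (t < T)%N -> threshold t <= M).
Hypothesis s_gt0 : 0 < s.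

Let ths0 : ths != [::].
Proof. by apply/eqP => h; move: a_ths; rewrite h. Qed.

Let rho1 : 0 < 1 - rho. Proof. by rewrite subr_gt0. Qed.

Local Notation alloc := (likelihood_rule ths f xstar).
Local Notation stat := (stats_of ths f xstar).

Definition lratio (S : @stats R) k th0 th : R := S.2 k th / S.2 k th0.
(** A wrong maximiser has ratio at least 1 to the true parameter, so this sum is at least 1 whenever
    arm [i] is misestimated; likewise [wrong_b] for arm [j]. *)
Definition wrong_a (S : @stats R) : R := \sum_(th <- ths | th != a) lratio S i a th `^ s.
Definition wrong_b (S : @stats R) : R := \sum_(th <- ths | th != b) lratio S j b th `^ s.
Definition total_b (S : @stats R) : R := \sum_(th <- ths) lratio S j b th.
(** At least 1 when, before time [T], a parameter above [b] survives for arm [i]: the factor [M]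
    makes up for the threshold. *)
Definition unrejected (S : @stats R) : R := M `^ s * \sum_(th <- ths | b < th) lratio S i a th `^ s.

(* The five terms pay, in this order, for the plays of the inferior arm [i] made while
   the estimate of [i] is wrong; that of [j] is wrong and [i] has not been played more
   than [j]; [b] has been wrongly rejected; the state is [stuck] (see below); both
   estimates are right. *)
Definition potential (S : @stats R) : R :=
  (1 - rho)^-1 * wrong_a S
  + (1 - rho)^-1 * (rho ^+ S.1 i / rho ^+ S.1 j * wrong_b S)
  + threshold_tail (S.1 true + S.1 false)%N * total_b S
  + ((1 - rho) * pmin)^-1 * wrong_b S
  + kappa^-1 * log_cap (unrejected S).

Definition positive_stats (S : @stats R) := forall k th, 0 < S.2 k th.

Lemma stats_of_positive h : positive_stats (stat h).
Proof.
elim/last_ind: h => [//|h [x y] IH] k th.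
by rewrite stats_of_rcons /=; case: ifP => _; rewrite ?mulr_gt0.
Qed.

Lemma stats_of_size h : ((stat h).1 true + (stat h).1 false)%N = size h.
Proof.
elim/last_ind: h => [//|h [x y] IH].
rewrite stats_of_rcons size_rcons -IH /=; case: (alloc h x); rewrite /= ?addn0 ?addn1 ?addSn//.
by rewrite addnS.
Qed.

Section one_state.
Variable S : @stats R.
Hypothesis S_gt0 : positive_stats S.

Let lratio_gt0 k th0 th : 0 < lratio S k th0 th.
Proof. by rewrite divr_gt0. Qed.

Lemma wrong_a_ge0 : 0 <= wrong_a S.
Proof. by apply: sumr_ge0 => th _; rewrite powR_ge0. Qed.
Lemma wrong_b_ge0 : 0 <= wrong_b S.
Proof. by apply: sumr_ge0 => th _; rewrite powR_ge0. Qed.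
Lemma total_b_ge0 : 0 <= total_b S.
Proof. by apply: sumr_ge0 => th _; rewrite ltW. Qed.
Lemma unrejected_ge0 : 0 <= unrejected S.
Proof. by rewrite mulr_ge0 ?powR_ge0//; apply: sumr_ge0 => th _; rewrite powR_ge0. Qed.

Lemma potential_ge0 : 0 <= potential S.
Proof.
have r0 : 0 <= (1 - rho)^-1 by rewrite invr_ge0 ltW.
rewrite /potential; apply: addr_ge0; last first.
  by rewrite mulr_ge0 ?invr_ge0 ?(ltW kappa_gt0)// log_cap_ge0// unrejected_ge0.
apply: addr_ge0; last first.
  by rewrite mulr_ge0 ?wrong_b_ge0// invr_ge0 mulr_ge0 ?(ltW pmin_gt0) ?(ltW rho1).
apply: addr_ge0; last by rewrite mulr_ge0 ?threshold_tail_ge0 ?total_b_ge0.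
apply: addr_ge0; first by rewrite mulr_ge0 ?wrong_a_ge0.
by rewrite !mulr_ge0 ?wrong_b_ge0 ?invr_ge0 ?exprn_ge0// ltW.
Qed.

Let ji : (j == i) = false. Proof. by rewrite /j; case: (i). Qed.
Let ij : (i == j) = false. Proof. by rewrite /j; case: (i). Qed.

Lemma lratio_update_self k x y th0 th :
  lratio (update f S k x y) k th0 th = lratio S k th0 th * (f th x y / f th0 x y).
Proof.
rewrite /lratio /= eqxx; field.
by rewrite !gt_eqF.
Qed.

Lemma lratio_update_other k k' x y th0 th : (k' == k) = false ->
  lratio (update f S k x y) k' th0 th = lratio S k' th0 th.
Proof. by rewrite /lratio /= => ->. Qed.

Lemma total_plays_update k x y :
  ((update f S k x y).1 true + (update f S k x y).1 false)%N = (S.1 true + S.1 false).+1.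
Proof. by case: k => /=; rewrite ?addn0 ?addn1 ?addSn ?addnS. Qed.

Lemma sum_lratio_power k x th0 (P : pred R) r :
  (forall th, th \in ths -> P th ->
    upper_mean (F (arm C k) x) (fun y => (f th x y / f th0 x y) `^ s) r) ->
  upper_mean (F (arm C k) x)
    (fun y => \sum_(th <- ths | P th) lratio (update f S k x y) k th0 th `^ s)
    (r * \sum_(th <- ths | P th) lratio S k th0 th `^ s).
Proof.
move=> H; rewrite -big_filter mulr_sumr.
apply: (@upper_mean_le _ _ (fun y => \sum_(th <- [seq th <- ths | P th])
   lratio S k th0 th `^ s * (f th x y / f th0 x y) `^ s) _ _ _ _ _ (upper_mean_sum _)).
- move=> y; rewrite -[leLHS]big_filter le_eqVlt; apply/orP; left; apply/eqP.
  apply: eq_bigr => th _; rewrite lratio_update_self powRM ?divr_ge0 ?ltW//.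
- exact: lexx.
- move=> th; rewrite mem_filter => /andP[Pth thin]; rewrite mulrC.
  by rewrite [X in upper_mean _ X]/= ; apply: upper_mean_scale; rewrite ?powR_ge0//; exact: H.
Qed.

Lemma wrong_b_update x y : wrong_b (update f S i x y) = wrong_b S.
Proof. by apply: eq_bigr => th _; rewrite lratio_update_other. Qed.

Lemma total_b_update x y : total_b (update f S i x y) = total_b S.
Proof. by apply: eq_bigr => th _; rewrite lratio_update_other. Qed.

Lemma wrong_a_update x y : wrong_a (update f S j x y) = wrong_a S.
Proof. by apply: eq_bigr => th _; rewrite lratio_update_other. Qed.

Lemma unrejected_update x y : unrejected (update f S j x y) = unrejected S.
Proof. by congr (_ * _); apply: eq_bigr => th _; rewrite lratio_update_other. Qed.

(** Term by term: [wrong_a] contracts by [rho]; one more play of [i] multiplies the weight of the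
    second term by [rho]; the tail steps down; the fourth term is constant; the last follows the
    tangent of [log_cap]. *)
Lemma potential_play_inferior x r : x \in xs ->
  (forall th, th \in ths -> b < th ->
    upper_mean (F a x) (fun y => (f th x y / f a x y) `^ s) r) ->
  upper_mean (F a x) (fun y => potential (update f S i x y))
    (potential S - (wrong_a S + rho ^+ S.1 i / rho ^+ S.1 j * wrong_b S
      + (threshold_tail (S.1 true + S.1 false)
         - threshold_tail (S.1 true + S.1 false).+1) * total_b S
      + kappa^-1 * (log_cap_slope (unrejected S) * ((1 - r) * unrejected S)))).
Proof.
move=> xX Hr; set t := (S.1 true + S.1 false)%N; set V := unrejected S.
have V0 : 0 <= V by exact: unrejected_ge0.
have r0 : 0 <= (1 - rho)^-1 by rewrite invr_ge0 ltW.
have k0 : 0 <= kappa^-1 by rewrite invr_ge0 ltW.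
have U1 : upper_mean (F a x) (fun y => (1 - rho)^-1 * wrong_a (update f S i x y))
    ((1 - rho)^-1 * (rho * wrong_a S)).
  apply: upper_mean_scale => //; apply: sum_lratio_power => th thin tha.
  exact: power_a.
have U2 : upper_mean (F a x) (fun y => (1 - rho)^-1 *
     (rho ^+ (update f S i x y).1 i / rho ^+ (update f S i x y).1 j
       * wrong_b (update f S i x y)))
    ((1 - rho)^-1 * (rho * (rho ^+ S.1 i / rho ^+ S.1 j) * wrong_b S)).
  apply: upper_mean_le (upper_mean_cst _ _) => //.
    by move=> y /=; rewrite wrong_b_update eqxx ji addn0 addn1 exprS !mulrA.
  by rewrite !mulr_ge0 ?wrong_b_ge0 ?invr_ge0 ?exprn_ge0// ltW.
have U3 : upper_mean (F a x) (fun y =>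
     threshold_tail ((update f S i x y).1 true + (update f S i x y).1 false)
       * total_b (update f S i x y)) (threshold_tail t.+1 * total_b S).
  apply: upper_mean_le (upper_mean_cst _ _) => //.
    by move=> y; rewrite total_b_update total_plays_update.
  by rewrite mulr_ge0 ?threshold_tail_ge0 ?total_b_ge0.
have U4 : upper_mean (F a x) (fun y => ((1 - rho) * pmin)^-1 * wrong_b (update f S i x y))
    (((1 - rho) * pmin)^-1 * wrong_b S).
  apply: upper_mean_le (upper_mean_cst _ _) => //.
    by move=> y; rewrite wrong_b_update.
  by rewrite mulr_ge0 ?wrong_b_ge0// invr_ge0 mulr_ge0 ?(ltW pmin_gt0) ?(ltW rho1).
have U5 : upper_mean (F a x) (fun y => kappa^-1 * log_cap (unrejected (update f S i x y)))
    (kappa^-1 * ((log_cap V - log_cap_slope V * V) + log_cap_slope V * (r * V))).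
  apply: upper_mean_scale => //.
  apply: (@upper_mean_le _ _ (fun y => (log_cap V - log_cap_slope V * V)
     + log_cap_slope V * unrejected (update f S i x y)) _ _ _ _ (lexx _)).
    move=> y; apply: log_cap_tangent => //.
    by rewrite mulr_ge0 ?powR_ge0//; apply: sumr_ge0 => th _; rewrite powR_ge0.
  apply: upper_mean_add; first exact/upper_mean_cst/log_cap_tangent_ge0.
  apply: upper_mean_scale; first exact: log_cap_slope_ge0.
  rewrite /V /unrejected mulrCA.
  by apply: upper_mean_scale; [exact: powR_ge0|exact: sum_lratio_power].
apply: upper_mean_le (upper_mean_add
  (upper_mean_add (upper_mean_add (upper_mean_add U1 U2) U3) U4) U5) => //.
rewrite /potential -/V -/t le_eqVlt; apply/orP; left; apply/eqP.
set q := rho ^+ S.1 i / rho ^+ S.1 j; field.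
by rewrite !gt_eqF.
Qed.

(** In the second term the contraction of [wrong_b] cancels the division by one more [rho]; in the
    third, ratios have mean at most 1; the fourth supplies the decrease. *)
Lemma potential_play_superior x : x \in xs ->
  upper_mean (F b x) (fun y => potential (update f S j x y))
    (potential S - pmin^-1 * wrong_b S).
Proof.
move=> xX; set t := (S.1 true + S.1 false)%N; set V := unrejected S.
have V0 : 0 <= V by exact: unrejected_ge0.
have r0 : 0 <= (1 - rho)^-1 by rewrite invr_ge0 ltW.
have Hb : upper_mean (F b x) (fun y => wrong_b (update f S j x y)) (rho * wrong_b S).
  by apply: sum_lratio_power => th thin tha; exact: power_b.
have U1 : upper_mean (F b x) (fun y => (1 - rho)^-1 * wrong_a (update f S j x y))
    ((1 - rho)^-1 * wrong_a S).
  apply: upper_mean_le (upper_mean_cst _ _) => //.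
    by move=> y; rewrite wrong_a_update.
  by rewrite mulr_ge0 ?wrong_a_ge0.
have U2 : upper_mean (F b x) (fun y => (1 - rho)^-1 *
     (rho ^+ (update f S j x y).1 i / rho ^+ (update f S j x y).1 j
       * wrong_b (update f S j x y)))
    ((1 - rho)^-1 * (rho ^+ S.1 i / rho ^+ (S.1 j).+1 * (rho * wrong_b S))).
  apply: upper_mean_scale => //.
  apply: (@upper_mean_le _ _ (fun y => rho ^+ S.1 i / rho ^+ (S.1 j).+1 *
     wrong_b (update f S j x y)) _ _ _ _ (lexx _)).
    by move=> y /=; rewrite eqxx ij addn0 addn1.
  by apply: upper_mean_scale => //; rewrite divr_ge0// exprn_ge0// ltW.
have U3 : upper_mean (F b x) (fun y =>
     threshold_tail ((update f S j x y).1 true + (update f S j x y).1 false)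
       * total_b (update f S j x y)) (threshold_tail t.+1 * total_b S).
  apply: (@upper_mean_le _ _ (fun y => threshold_tail t.+1 * \sum_(th <- ths)
      lratio S j b th * (f th x y / f b x y)) _ _ _ _ (lexx _)).
    move=> y; rewrite total_plays_update le_eqVlt; apply/orP; left; apply/eqP.
    by congr (_ * _); apply: eq_bigr => th _; rewrite lratio_update_self.
  apply: upper_mean_scale; first exact: threshold_tail_ge0.
  apply: upper_mean_sum => th thin; rewrite -[X in upper_mean _ _ X]mulr1.
  by apply: upper_mean_scale; [rewrite ltW|exact: ratio_b].
have U4 : upper_mean (F b x) (fun y => ((1 - rho) * pmin)^-1 * wrong_b (update f S j x y))
    (((1 - rho) * pmin)^-1 * (rho * wrong_b S)).
  by apply: upper_mean_scale => //; rewrite invr_ge0 mulr_ge0 ?(ltW pmin_gt0) ?(ltW rho1).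
have U5 : upper_mean (F b x) (fun y => kappa^-1 * log_cap (unrejected (update f S j x y)))
    (kappa^-1 * log_cap V).
  apply: upper_mean_le (upper_mean_cst _ _) => //.
    by move=> y; rewrite unrejected_update.
  by rewrite mulr_ge0 ?log_cap_ge0// invr_ge0 ltW.
apply: upper_mean_le (upper_mean_add
  (upper_mean_add (upper_mean_add (upper_mean_add U1 U2) U3) U4) U5) => //.
have tail : threshold_tail t.+1 * total_b S <= threshold_tail t * total_b S.
  apply: ler_wpM2r; first exact: total_b_ge0.
  rewrite -subr_ge0; apply: le_trans (threshold_tailB _ t).
  by rewrite invr_ge0 ltW// threshold_gt0.
rewrite /potential -/V -/t.
have -> : rho ^+ S.1 i / rho ^+ (S.1 j).+1 * (rho * wrong_b S)
   = rho ^+ S.1 i / rho ^+ S.1 j * wrong_b S.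
  by rewrite exprS; field; rewrite expf_neq0 gt_eqF.
have -> : pmin^-1 * wrong_b S = ((1 - rho) * pmin)^-1 * wrong_b S
    - ((1 - rho) * pmin)^-1 * (rho * wrong_b S).
  by field; rewrite !gt_eqF.
lra.
Qed.

End one_state.
Lemma lratio_argmax_ge1 S k th0 : positive_stats S -> th0 \in ths ->
  1 <= lratio S k th0 (argmax ths (S.2 k)).
Proof. by move=> S0 th0in; rewrite ler_pdivlMr// mul1r argmaxP. Qed.

Lemma powR_ge1 (z : R) : 1 <= z -> 1 <= z `^ s.
Proof.
move=> z1; rewrite -[leLHS](powRr0 z); apply: ler_powR => //; exact: ltW.
Qed.

Lemma wrong_a_ge1 S : positive_stats S -> argmax ths (S.2 i) != a -> 1 <= wrong_a S.
Proof.
move=> S0 na; apply: le_trans (powR_ge1 (lratio_argmax_ge1 i S0 a_ths)) _.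
apply: (@le_term_sum _ _ (fun th => th != a) (fun th => lratio S i a th `^ s)) => //.
  by move=> y; exact: powR_ge0.
exact: argmax_in.
Qed.

Lemma wrong_b_ge1 S : positive_stats S -> argmax ths (S.2 j) != b -> 1 <= wrong_b S.
Proof.
move=> S0 na; apply: le_trans (powR_ge1 (lratio_argmax_ge1 j S0 b_ths)) _.
apply: (@le_term_sum _ _ (fun th => th != b) (fun th => lratio S j b th `^ s)) => //.
  by move=> y; exact: powR_ge0.
exact: argmax_in.
Qed.

Section step.
Variable h : seq (R * R).
Hypothesis hT : (size h < T)%N.
Let S := stat h.
Let e k := argmax ths (S.2 k).
Let leader := e false < e true.
Let surv k := survivors ths (threshold (S.1 true + S.1 false)) (S.2 k).

Let S_gt0 : positive_stats S := @stats_of_positive h.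

Lemma rule_inferior_cases x : alloc h x = i ->
  (leader = i /\ ~~ [&& survivor_above ths (e i) (surv j), x == xstar (e j) (e i)
     & (S.1 j <= S.1 i)%N]) \/
  (leader = j /\ [&& survivor_above ths (e j) (surv i), x == xstar (e i) (e j)
     & (S.1 i <= S.1 j)%N]).
Proof.
rewrite /likelihood_rule /choose_arm /decide -/S.
rewrite -/(argmax ths (S.2 false)) -/(argmax ths (S.2 true)) -/(e _) -/(e _) -/leader.
case: ifPn => cond leq.
- right; have lj : leader = j by rewrite /j -leq negbK.
  by split => //; move: cond; rewrite lj /j negbK.
- by left; split => //; move: cond; rewrite leq.
Qed.

Lemma leader_correct : e i = a -> e j = b -> leader = j.
Proof.
rewrite /leader /j; move: ab; rewrite /a /b /j.
case: (i) => /= ab' -> ->; first by rewrite lt_gtF.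
by rewrite ab'.
Qed.

(* The only states in which an inferior play need not decrease the potential. Since [j]
   is then played at the covariate [xstar (e j) (e i)], averaging over covariates
   compensates. *)
Definition stuck := [&& leader == i, survivor_above ths (e i) (surv j),
  (S.1 j <= S.1 i)%N, e i == a & e j != b].

Lemma rule_stuck : stuck -> alloc h (xstar (e j) (e i)) = j.
Proof.
move=> /and5P[/eqP li sv NN _ _].
rewrite /likelihood_rule /choose_arm /decide -/S.
rewrite -/(argmax ths (S.2 false)) -/(argmax ths (S.2 true)) -/(e _) -/(e _) -/leader.
rewrite li -/j -/(e i) -/(e j).
by rewrite -[nth _ _ (argmax_index _ (S.2 i))]/(e i)
  -[nth _ _ (argmax_index _ (S.2 j))]/(e j) sv eqxx NN.
Qed.

(** Guaranteed mean decrease of the potential given the covariate [x]. *)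
Definition step_decrease x : R :=
  if alloc h x == i then (~~ stuck)%:R else if stuck then pmin^-1 else 0.

(** Outside stuck states, one of the four decreases of [potential_play_inferior] is at least 1;
    which one depends on the estimates and the play counts. *)
Lemma inferior_play_decrease x : x \in xs -> alloc h x = i ->
  upper_mean (F a x) (fun y => potential (update f S i x y)) (potential S - (~~ stuck)%:R).
Proof.
move=> xX ri.
pose r := if x == xstar a b then 1 - kappa else 1.
have Hr th : th \in ths -> b < th ->
    upper_mean (F a x) (fun y => (f th x y / f a x y) `^ s) r.
  move=> thin bth; rewrite /r; case: eqP => [->|_]; first exact: power_star.
  apply: upper_mean_le (power_a xX thin _) => //; first exact: ltW.
  by rewrite gt_eqF// (lt_trans ab).
apply: upper_mean_le (potential_play_inferior S_gt0 xX Hr) => //.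
rewrite lerD2l lerN2; set t := (_ + _)%N; set V := unrejected S.
have V0 : 0 <= V by exact: unrejected_ge0.
have w1 : 0 <= wrong_a S by exact: wrong_a_ge0.
have w2 : 0 <= rho ^+ S.1 i / rho ^+ S.1 j * wrong_b S.
  by rewrite mulr_ge0 ?wrong_b_ge0// divr_ge0// exprn_ge0// ltW.
have w3' : (threshold t)^-1 * total_b S <= (threshold_tail t - threshold_tail t.+1) * total_b S.
  by apply: ler_wpM2r; [exact: total_b_ge0|exact: threshold_tailB].
have w3 : 0 <= (threshold_tail t - threshold_tail t.+1) * total_b S.
  by apply: le_trans w3'; rewrite mulr_ge0 ?total_b_ge0// invr_ge0 ltW// threshold_gt0.
have w4 : 0 <= kappa^-1 * (log_cap_slope V * ((1 - r) * V)).
  rewrite mulr_ge0 ?invr_ge0 ?(ltW kappa_gt0)// mulr_ge0 ?log_cap_slope_ge0// mulr_ge0//.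
  by rewrite /r; case: ifP => _; rewrite ?subrr// opprB addrC subrK ltW.
case: (boolP stuck) => nst /=; first by rewrite !addr_ge0.
apply: ge1_add4 => //.
have [ea|ea] := eqVneq (e i) a; last by constructor 1; exact: wrong_a_ge1.
(* With both estimates right, [j] leads and [i] is played as exploration: the covariate is
   [xstar a b] and a parameter above [b] survives, whence [V >= 1]. *)
have [eb|eb] := eqVneq (e j) b.
  have lj := leader_correct ea eb.
  have [[li _]|[_]] := rule_inferior_cases ri.
    by move: lj; rewrite li /j; case: (i).
  rewrite ea eb => /and3P[sv /eqP xE _].
  have V1 : 1 <= V.
    have [th [thin bth /(_ _ a_ths) aP]] := survivor_aboveP _ _ _ _ sv.
    have Mr : 1 <= M * lratio S i a th.
      rewrite mulrA ler_pdivlMr// mul1r (le_trans (ltW aP))// ler_wpM2r//; first exact: ltW.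
      by apply: threshold_M; rewrite stats_of_size.
    apply: (le_trans (powR_ge1 Mr)); rewrite powRM; [|exact: ltW|by rewrite ltW// divr_gt0].
    rewrite /V /unrejected.
    apply: ler_wpM2l; first exact: powR_ge0.
    apply: (@le_term_sum _ _ (fun th => b < th) (fun th => lratio S i a th `^ s)) => //.
    by move=> y; exact: powR_ge0.
  constructor 4; rewrite /r xE eqxx opprB addrC subrK (mulrCA (log_cap_slope V)) log_cap_slopeM//.
  by rewrite mulr1 mulVf// gt_eqF.
(* The estimate of [j] is wrong from here on. If [i] has no more plays than [j], the quotient of
   powers of [rho] is at least 1. *)
have [NN|NN] := leqP (S.1 i) (S.1 j).
  constructor 2; rewrite -[leLHS]mulr1; apply: ler_pM => //; last exact: wrong_b_ge1.
  by rewrite ler_pdivlMr ?exprn_gt0// mul1r ler_wiXn2l// ltW.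
(* Having more plays than [j], arm [i] is not explored, so it leads. The state is not stuck, so
   nothing above [a] survives for [j]; in particular [b] is rejected, and some ratio to [b] reaches
   the threshold. *)
have [[li]|[_]] := rule_inferior_cases ri; last by rewrite leqNgt NN !andbF.
move: nst; rewrite /stuck li eqxx (ltnW NN) ea eqxx eb /= !andbT => nsv _.
have [th thin thP] : exists2 th, th \in ths & threshold t <= lratio S j b th.
  apply: contrapT => H; move/survivor_aboveP: nsv; apply.
  exists b; split => // th thin; rewrite ltNge; apply/negP => K; apply: H.
  by exists th => //; rewrite ler_pdivlMr.
constructor 3; apply: le_trans w3'.
rewrite mulrC ler_pdivlMr ?threshold_gt0// mul1r (le_trans thP)//.
apply: (@le_term_sum R R xpredT (fun th => lratio S j b th)) => //.
by move=> y; rewrite ltW// divr_gt0.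
Qed.

Lemma superior_play_decrease x : x \in xs ->
  upper_mean (F b x) (fun y => potential (update f S j x y))
    (potential S - if stuck then pmin^-1 else 0).
Proof.
move=> xX; apply: upper_mean_le (potential_play_superior S_gt0 xX) => //.
rewrite lerD2l lerN2; case: ifPn => [/and5P[_ _ _ _ eb]|_].
  by rewrite ler_peMr ?invr_ge0 ?(ltW pmin_gt0)// wrong_b_ge1.
by rewrite mulr_ge0 ?wrong_b_ge0// invr_ge0 ltW.
Qed.

Lemma step_decreaseP x : x \in xs ->
  upper_mean (F (arm C (alloc h x)) x) (fun y => potential (stat (rcons h (x, y))))
    (potential S - step_decrease x).
Proof.
move=> xX; rewrite /step_decrease; case: eqP => [ri|/eqP/negbTE/neq_bool_neg ri].
  have := inferior_play_decrease xX ri; rewrite ri.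
  by apply: upper_mean_le => // y; rewrite stats_of_rcons ri.
have := superior_play_decrease xX; rewrite ri -/j.
by apply: upper_mean_le => // y; rewrite stats_of_rcons ri.
Qed.

Lemma inferior_superior x : x \in xs -> inferior F C x j = false.
Proof.
by move=> xX; rewrite /inferior /j negbK; apply/negbTE; rewrite -leNgt ltW// mean_ab.
Qed.

Lemma step_sum : \sum_(x <- xs) p x *
   ((inferior F C x (alloc h x))%:R + (potential S - step_decrease x)) <= potential S.
Proof.
have p0 x : x \in xs -> 0 <= p x by move=> xX; rewrite (le_trans (ltW pmin_gt0))// p_ge.
pose x0 := xstar (e j) (e i).
have -> : \sum_(x <- xs) p x *
   ((inferior F C x (alloc h x))%:R + (potential S - step_decrease x)) =
   potential S + \sum_(x <- xs) p x * ((inferior F C x (alloc h x))%:R - step_decrease x).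
  under eq_bigr do rewrite addrCA mulrDr.
  by rewrite big_split/= -mulr_suml p_sum mul1r.
rewrite gerDl; case: (boolP stuck) => st; last first.
  rewrite big_seq; apply: sumr_le0 => x xX; apply: mulr_ge0_le0; first exact: p0.
  rewrite subr_le0 /step_decrease (negbTE st); case: eqP => [ri|/eqP/negbTE/neq_bool_neg ri].
    by rewrite lern1 leq_b1.
  by rewrite ri inferior_superior.
(* At [x0], of mass at least [pmin], arm [j] is played and the weighted decrease is at least 1;
   every other covariate costs at most its mass, and the masses sum to 1. *)
apply: (@le_trans _ _ (\sum_(x <- xs) (p x - (x == x0)%:R))).
  rewrite big_seq [leRHS]big_seq; apply: ler_sum => x xX.
  have [->|xx0] := eqVneq x x0.
    have x0X : x0 \in xs by exact: xstar_xs.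
    have ji : (j == i) = false by rewrite /j; case: (i).
    have -> : step_decrease x0 = pmin^-1 by rewrite /step_decrease (rule_stuck st) ji st.
    rewrite (rule_stuck st) (inferior_superior x0X).
    rewrite sub0r mulrN -opprB lerN2 lerBlDr.
    have p1 : 1 <= p x0 / pmin by rewrite ler_pdivlMr// mul1r p_ge.
    by rewrite (le_trans p1)// lerDl p0.
  rewrite subr0 -[leRHS]mulr1 ler_wpM2l ?p0// lerBlDr.
  apply: (@le_trans _ _ 1); first by rewrite lern1 leq_b1.
  rewrite lerDl /step_decrease st; case: ifP => // _.
  by rewrite invr_ge0 ltW.
rewrite sumrB p_sum subr_le0.
have := @le_term_sum R R xpredT (fun x => (x == x0)%:R) xs x0 (fun=> ler0n _ _) (xstar_xs _ _) isT.
by rewrite eqxx.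
Qed.

End step.

Hypothesis M_ge1 : 1 <= M.

(** The potential on the empty history, where all ratios are 1. Only [log_cap] of [unrejected]
    involves [M], through the logarithm of [M ^ s]. *)
Lemma ETinf_le (G : probability R R) : (forall x, fine (G [set x]) = p x) ->
  (ETinf [set` xs] G F alloc C T <=
  ((size ths)%:R * ((1 - rho)^-1 *+ 2 + 1 + ((1 - rho) * pmin)^-1)
   + kappa^-1 * (1 + ln (size ths)%:R + s * ln M))%:E)%E.
Proof.
move=> Gp.
have := @Eh_potential _ xs G F alloc C uniq_xs T (fun h => potential (stat h)).
move=> /(_ _ _ _ T [::]) H; apply: le_trans (H _ _ _ _) _ => //.
- by move=> h; apply: potential_ge0; exact: stats_of_positive.
- move=> h hT; exists (fun x => potential (stat h) - step_decrease h x).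
    by move=> x xX; exact: step_decreaseP.
  by under eq_bigr do rewrite Gp; exact: step_sum.
- by under eq_bigr do rewrite Gp.
rewrite lee_fin add0r /potential /=.
set m := (size ths)%:R : R.
have m1 : 1 <= m by rewrite ler1n; case: (ths) ths0.
have lr k th0 th : lratio (stat [::]) k th0 th = 1 by rewrite /lratio /= divr1.
have sumP (P : pred R) : \sum_(th <- ths | P th) (1 : R) <= m.
  by rewrite big_const_seq iter_addr_0 ler_nat count_size.
have wa : wrong_a (stat [::]) <= m.
  by rewrite /wrong_a; under eq_bigr do rewrite lr powR1; exact: sumP.
have wb : wrong_b (stat [::]) <= m.
  by rewrite /wrong_b; under eq_bigr do rewrite lr powR1; exact: sumP.
have tb : total_b (stat [::]) <= m.
  by rewrite /total_b; under eq_bigr do rewrite lr; exact: sumP.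
have ur : unrejected (stat [::]) <= M `^ s * m.
  rewrite /unrejected; under eq_bigr do rewrite lr powR1.
  by rewrite ler_wpM2l ?powR_ge0.
have Ms : 1 <= M `^ s by exact: powR_ge1.
have lc : log_cap (unrejected (stat [::])) <= 1 + ln m + s * ln M.
  rewrite -addrA [ln m + _]addrC -ln_powR -lnM ?posrE ?powR_gt0//; last exact: lt_le_trans m1.
  apply: log_cap_le_ln; first by rewrite ur unrejected_ge0//; exact: (@stats_of_positive [::]).
  by rewrite -[leLHS]mulr1 ler_pM.
have r0 : 0 <= (1 - rho)^-1 by rewrite invr_ge0 ltW.
have tl : threshold_tail 0 = 1 :> R by rewrite /threshold_tail ln1 addr0 invr1.
have -> : m * ((1 - rho)^-1 *+ 2 + 1 + ((1 - rho) * pmin)^-1) = (1 - rho)^-1 * m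
   + (1 - rho)^-1 * (1 * m) + 1 * m + ((1 - rho) * pmin)^-1 * m by ring.
rewrite expr0 divr1 tl.
by rewrite !lerD// ler_wpM2l// ?mul1r// invr_ge0 ?mulr_ge0
  ?(ltW pmin_gt0) ?(ltW rho1) ?(ltW kappa_gt0).
Qed.

End drift.

(** * Measurability of the rule *)

Section discrete_measurability.
Context {d} {T : measurableType d}.

Definition discrete_measurable (A : Type) (u : T -> A) :=
  forall B : set A, measurable (u @^-1` B).

Lemma discrete_measurable_cst (A : Type) (c : A) : discrete_measurable (fun _ : T => c).
Proof.
by move=> B; rewrite preimage_cst; case: ifP.
Qed.

Lemma discrete_measurable_comp (A A' : Type) (g : A -> A') (u : T -> A) :
  discrete_measurable u -> discrete_measurable (fun t => g (u t)).
Proof. by move=> mu B; exact: (mu (g @^-1` B)). Qed.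

(** Decomposition along the countably many values of [u]. *)
Lemma discrete_measurable_pair (A : countType) (B : Type) (u : T -> A) (v : T -> B) :
  discrete_measurable u -> discrete_measurable v ->
  discrete_measurable (fun t => (u t, v t)).
Proof.
move=> mu mv E.
have -> : (fun t => (u t, v t)) @^-1` E =
    \bigcup_n (if unpickle n is Some a then u @^-1` [set a] `&` v @^-1` [set b | E (a, b)]
               else set0).
  apply/seteqP; split => t /=.
    by move=> Et; exists (pickle (u t)) => //=; rewrite pickleK.
  by move=> [n _]; case: unpickle => //= a [/= -> ].
apply: bigcupT_measurable => n; case: unpickle => // a.
by apply: measurableI.
Qed.

Lemma discrete_measurable_bool (u : T -> bool) :
  measurable_fun setT u -> discrete_measurable u.
Proof. by move=> mu B; rewrite -[X in measurable X]setTI; exact: mu. Qed.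

Lemma discrete_measurable_fun {d'} (T' : measurableType d') (u : T -> T') :
  discrete_measurable u -> measurable_fun setT u.
Proof. by move=> mu _ B _; rewrite setTI; exact: mu. Qed.

Lemma discrete_measurable_map (I : Type) (A : countType) (r : seq I) (u : I -> T -> A) :
  (forall i, discrete_measurable (u i)) ->
  discrete_measurable (fun t => [seq u i t | i <- r]).
Proof.
move=> mu; elim: r => [|i r IH] /=; first exact: discrete_measurable_cst.
exact: (discrete_measurable_comp (fun q => q.1 :: q.2) (discrete_measurable_pair (mu i) IH)).
Qed.

End discrete_measurability.

Section rule_measurability.
Context {R : realType} (ths : seq R) (f : R -> R -> R -> R) (xstar : R -> R -> R).
Hypothesis mf : forall th x, measurable_fun setT (f th x).

Section on_measurable_space.
Context {d} {T : measurableType d}.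

Lemma discrete_measurable_argmax (L : R -> T -> R) :
  (forall th, measurable_fun setT (L th)) ->
  discrete_measurable (fun t => argmax_index ths (L^~ t)).
Proof.
move=> mL; apply: (discrete_measurable_comp (find id)).
apply: (@discrete_measurable_map _ _ _ _ ths
  (fun th t => all id [seq L th' t <= L th t | th' <- ths])) => th.
apply: (discrete_measurable_comp (all id)).
apply: (@discrete_measurable_map _ _ _ _ ths (fun th' t => L th' t <= L th t)) => th'.
by apply: discrete_measurable_bool; exact: measurable_fun_ler.
Qed.

Lemma discrete_measurable_survivors (k : T -> R) (L : R -> T -> R) :
  measurable_fun setT k -> (forall th, measurable_fun setT (L th)) ->
  discrete_measurable (fun t => survivors ths (k t) (L^~ t)).
Proof.
move=> mk mL.
apply: (@discrete_measurable_map _ _ _ _ ths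
  (fun th t => all id [seq L th' t < k t * L th t | th' <- ths])) => th.
apply: (discrete_measurable_comp (all id)).
apply: (@discrete_measurable_map _ _ _ _ ths (fun th' t => L th' t < k t * L th t)) => th'.
apply: discrete_measurable_bool; apply: measurable_fun_ltr => //.
exact: measurable_funM.
Qed.

Lemma bool_funE (A : Type) (g : bool -> A) : g = (fun k => if k then g true else g false).
Proof. by apply/funext; case. Qed.

(** The statistics enter only through counts, indices and masks. Functions of the arm are encoded as
    pairs, to which [discrete_measurable_pair] applies. *)
Lemma discrete_measurable_choose_arm (S : T -> @stats R) x :
  (forall k, discrete_measurable (fun t => (S t).1 k)) ->
  (forall k th, measurable_fun setT (fun t => (S t).2 k th)) ->
  discrete_measurable (fun t => choose_arm ths xstar (S t) x).
Proof.
move=> mN mL.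
have mk : measurable_fun setT (fun t => threshold ((S t).1 true + (S t).1 false) : R).
  apply: discrete_measurable_fun.
  exact: (discrete_measurable_comp (fun q => threshold (q.1 + q.2)%N)
    (discrete_measurable_pair (mN true) (mN false))).
have mE k := discrete_measurable_argmax (mL k).
have mS k := discrete_measurable_survivors mk (mL k).
have := discrete_measurable_pair (discrete_measurable_pair (discrete_measurable_pair
  (mN true) (mN false)) (discrete_measurable_pair (mE true) (mE false)))
  (discrete_measurable_pair (mS true) (mS false)).
move/(discrete_measurable_comp (fun q => decide ths xstar
  (fun k : bool => if k then q.1.1.1 else q.1.1.2)
  (fun k : bool => if k then q.1.2.1 else q.1.2.2)
  (fun k : bool => if k then q.2.1 else q.2.2) x)).
congr (discrete_measurable _); apply/funext => t /=; rewrite /choose_arm.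
by congr decide; apply/esym; rewrite [LHS]bool_funE.
Qed.

Lemma stats_of_measurable (X : nat -> R) (Y : nat -> T -> R) n :
  (forall m, measurable_fun setT (Y m)) ->
  (forall k, discrete_measurable (fun t =>
     (stats_of ths f xstar (mkseq (fun m => (X m, Y m t)) n)).1 k)) /\
  (forall k th, measurable_fun setT (fun t =>
     (stats_of ths f xstar (mkseq (fun m => (X m, Y m t)) n)).2 k th)).
Proof.
move=> mY; elim: n => [|n [IHN IHL]].
  split => [k|k th]; first exact: discrete_measurable_cst.
  exact: measurable_cst.
have mb := discrete_measurable_choose_arm (X n) IHN IHL.
split => [k|k th].
- under eq_fun do rewrite mkseqS stats_of_rcons /=.
  exact: (discrete_measurable_comp (fun q => q.1 + (k == q.2))%N
    (discrete_measurable_pair (IHN k) mb)).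
- under eq_fun do rewrite mkseqS stats_of_rcons /=.
  apply: measurable_fun_ifT => //.
  + by apply: discrete_measurable_fun; exact: (discrete_measurable_comp (fun c => k == c) mb).
  + apply: measurable_funM => //.
    exact: (measurableT_comp (mf th (X n)) (mY n)).
Qed.

End on_measurable_space.

(** The sets of tuples whose image belongs to the generated sigma-algebra form a sigma-algebra
    themselves, and it contains the preimages under coordinates. *)
Lemma tuple_measurable_cyl n (A : set (n.-tuple R)) : measurable A ->
  <<s [set ys : seq R | size ys = n], @cyl R n >> [set tval t | t in A].
Proof.
pose D := [set ys : seq R | size ys = n].
move=> mA.
suff : measurable `<=` [set B : set (n.-tuple R) | <<s D, @cyl R n >> [set tval t | t in B]].
  exact.
apply: smallest_sub.
  split => /=.
  - by rewrite image_set0; exact: sigma_algebra0.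
  - move=> B sB; rewrite (_ : [set tval t | t in setT `\` B] = D `\` [set tval t | t in B]).
      exact: sigma_algebraCD.
    apply/seteqP; split => ys /=.
      move=> [t [_ nB] <-]; split; first by rewrite /D /= size_tuple.
      by move=> [t' Bt' /val_inj tt]; apply: nB; rewrite -tt.
    move=> [/eqP sn nB]; exists (Tuple sn) => //; split => // Bt; apply: nB.
    by exists (Tuple sn).
  - move=> B sB; rewrite image_bigcup; exact: sigma_algebra_bigcup.
case: n => [|n] in A mA D *; first by rewrite big_ord0.
rewrite -bigcup_mkord_ord; apply: bigcup_sub => i /= ni _ [B mB <-] /=.
(* A coordinate preimage is a rectangle whose other sides are the whole line. *)
apply: sub_sigma_algebra; exists (fun k => if k == i then B else setT); split.
  by move=> k; case: ifP.
apply/seteqP; split => ys /=.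
  move=> [t [_ Bt] <-]; split; first by rewrite size_tuple.
  move=> k kn; case: eqP => // ->.
  by move: Bt; rewrite (tnth_nth 0) inordK.
move=> [/eqP sn H]; exists (Tuple sn) => //; split => //.
by have := H i ni; rewrite eqxx (tnth_nth 0) inordK.
Qed.

Lemma likelihood_rule_measurable : rule_measurable (likelihood_rule ths f xstar).
Proof.
move=> n xs x sxs.
pose Y m (t : n.-tuple R) := nth 0 (tval t) m.
have mY m : measurable_fun setT (Y m).
  rewrite /Y; case: (ltnP m n) => [mn|nm].
    rewrite (_ : (fun t : n.-tuple R => nth 0 t m) = (fun t => tnth t (Ordinal mn))).
      exact: measurable_tnth.
    by apply/funext => t; rewrite (tnth_nth 0).
  rewrite (_ : (fun t : n.-tuple R => nth 0 t m) = cst 0); first exact: measurable_cst.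
  by apply/funext => t; rewrite nth_default// size_tuple.
have [mN mL] := stats_of_measurable (nth 0 xs) n mY.
have := tuple_measurable_cyl (discrete_measurable_choose_arm x mN mL [set true]).
congr (<<s _, _ >> _); apply/seteqP.
have zipE (t : n.-tuple R) : zip xs t = mkseq (fun m => (nth 0 xs m, Y m t)) n.
  apply: (@eq_from_nth _ (0, 0)); first by rewrite size_zip size_mkseq sxs size_tuple minnn.
  move=> k; rewrite size_zip sxs size_tuple minnn => kn.
  by rewrite nth_zip ?size_tuple// nth_mkseq.
split => ys /=.
  by move=> [t Ht <-]; rewrite size_tuple zipE /likelihood_rule Ht.
move=> [/eqP sn Ht]; exists (Tuple sn) => //=.
by rewrite -zipE.
Qed.

End rule_measurability.

(** * Regret bound and limits *)

(** Minimum over a finite family, for properties inherited by smaller positive numbers. *)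
Lemma exists_uniform_pos (R : realType) (I : eqType) (r : seq I) (P : I -> R -> Prop) :
  (forall q s s', 0 < s <= s' -> P q s' -> P q s) ->
  (forall q, q \in r -> exists2 s, 0 < s & P q s) ->
  exists2 s, 0 < s <= 1 & forall q, q \in r -> P q s.
Proof.
move=> Pdown; elim: r => [|q r IH] H; first by exists 1; rewrite ?ltr01 ?lexx.
have [s1 /andP[s10 s11] P1] : exists2 s, 0 < s <= 1 & forall q, q \in r -> P q s.
  by apply: IH => q' q'r; apply: H; rewrite inE q'r orbT.
have [s2 s20 P2] := H q (mem_head _ _).
exists (Num.min s1 s2); first by rewrite lt_min s10 s20 ge_min s11.
move=> q'; rewrite inE => /predU1P[->|q'r].
  by apply: Pdown P2; rewrite lt_min s10 s20 ge_min lexx orbT.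
by apply: Pdown (P1 _ q'r); rewrite lt_min s10 s20 ge_min lexx.
Qed.

(** [t + 2 <= 3 * t] handles the shift; [ln y <= y - 1] at [y = delta * (1 + ln (t+2))] bounds the
    double logarithm. *)
Lemma ln_threshold_le (R : realType) (delta : R) : 0 < delta ->
  exists c : R, forall t, (0 < t)%N ->
    ln (threshold t) <= c + (1 + 2 * delta) * ln t%:R :> R.
Proof.
move=> d0; pose c1 : R := (1 + 2 * delta) * ln 3 + 2 * (delta - 1 - ln delta).
exists c1 => t t0.
have l3 : ln t.+2%:R <= ln 3 + ln t%:R :> R.
  rewrite -lnM ?posrE ?ltr0n// ler_ln ?posrE ?mulr_gt0 ?ltr0n//.
  rewrite -natrM ler_nat; case: t t0 => // t _.
  by rewrite mulnS -(addn3 t) addnC leq_add2l leq_pmull.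
have z0 : 0 <= ln t.+2%:R :> R by rewrite ln_ge0// ler1n.
have z1 : 0 < 1 + ln t.+2%:R :> R by rewrite ltr_pwDl.
rewrite /threshold lnM ?posrE ?exprn_gt0// lnXn//.
set z := ln t.+2%:R in l3 z0 z1 *.
have : ln (delta * (1 + z)) <= delta * (1 + z) - 1 by apply: ln_leB1; exact: mulr_gt0.
rewrite lnM ?posrE// /c1 mulr2n => hz.
have : (1 + 2 * delta) * z <= (1 + 2 * delta) * (ln 3 + ln t%:R).
  by apply: ler_wpM2l => //; lra.
move: (ln t%:R) (ln 3) (ln delta) (ln (1 + z)) hz => u3 u1 u2 u4; lra.
Qed.

Section regret.
Context {R : realType} (ths xs : seq R) (G : probability R R)
  (F : R -> R -> probability R R) (f : R -> R -> R -> R) (xstar : R -> R -> R).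
Hypothesis uniq_xs : uniq xs.
Hypothesis G_gt0 : forall x, x \in xs -> (0 < G [set x])%E.
Hypothesis G_sum : \sum_(x <- xs) fine (G [set x]) = 1.
Hypothesis KL_bounds : forall c th x, c \in ths -> th \in ths -> x \in xs -> c != th ->
  (0 < KL (F c x) (F th x) < +oo)%E.
Hypothesis mean_lt : forall c th x, c \in ths -> th \in ths -> x \in xs -> c < th ->
  (mean (F c x) < mean (F th x))%E.
Hypothesis f_gt0 : forall th x y, 0 < f th x y.
Hypothesis mf : forall th x, measurable_fun setT (f th x).
Hypothesis f_ratio : forall c th x, c \in ths -> th \in ths -> x \in xs ->
  (\int[F c x]_y (f th x y / f c x y)%:E <= 1)%E.
Hypothesis f_KL : forall c th x, c \in ths -> th \in ths -> x \in xs ->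
  KL (F c x) (F th x) = (\int[F c x]_y (- ln (f th x y / f c x y))%:E)%E.
Hypothesis xstar_xs : forall c d, xstar c d \in xs.

Local Notation alloc := (likelihood_rule ths f xstar).

Lemma power_small c th x (l : R) : c \in ths -> th \in ths -> x \in xs -> c != th ->
  (l%:E < KL (F c x) (F th x))%E -> exists2 s0 : R, 0 < s0 <= 1 & forall s, 0 < s <= s0 ->
    upper_mean (F c x) (fun y => (f th x y / f c x y) `^ s) (1 - s * l).
Proof.
move=> cth thth xX cnth lKL; have /andP[K0 Koo] := KL_bounds cth thth xX cnth.
have mr : measurable_fun setT (fun y => f th x y / f c x y) by exact: measurable_fun_ratio.
have r0 y : 0 < f th x y / f c x y by rewrite divr_gt0.
have Kfin : KL (F c x) (F th x) \is a fin_num by rewrite ge0_fin_numE// ltW.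
pose I := fine (KL (F c x) (F th x)).
have lI : 0 < I - l by rewrite subr_gt0 -lte_fin fineK.
have [|s0 s01 H] := integral_powR_small r0 mr (f_ratio cth thth xX) (I := I) lI.
  by rewrite -f_KL// fineK.
exists s0 => // s ss; apply: upper_mean_self.
- exact: measurable_powR_comp.
- by move=> y; exact: powR_ge0.
- by have := H s ss; rewrite subKr.
Qed.

Section configuration.
Variables (C : R * R) (i : bool).
Hypothesis C_ths : forall k, arm C k \in ths.
Hypothesis arm_lt : arm C i < arm C (~~ i).
Variable K : R.
Hypothesis K_gt0 : 0 < K.
Hypothesis K_lt : forall th, th \in ths -> arm C (~~ i) < th ->
  (K%:E < KL (F (arm C i) (xstar (arm C i) (arm C (~~ i))))
    (F th (xstar (arm C i) (arm C (~~ i)))))%E.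

Lemma ETinf_le_ln_threshold : exists c : R, forall T,
  (ETinf [set` xs] G F alloc C T <= (c + K^-1 * ln (threshold T))%:E)%E.
Proof.
pose a := arm C i; pose b := arm C (~~ i); pose x0 := xstar a b.
(* Contraction rates strictly below the Kullback-Leibler numbers: [K] for the exploration that sets
   the leading constant, half the number otherwise. *)
pose l (q : R * R * R) : R := let: (x, c, th) := q in
  if [&& x == x0, c == a & b < th] then K else fine (KL (F c x) (F th x)) / 2.
pose Q := [seq q <- [seq (p, th) | p <- [seq (x, c) | x <- xs, c <- ths], th <- ths]
             | q.1.2 != q.2].
have QP x c th : ((x, c, th) \in Q) = [&& c != th, x \in xs, c \in ths & th \in ths].
  rewrite mem_filter /=; congr (_ && _); apply/idP/idP.
    move=> /allpairsP[[[x' c'] th'] /=].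
    by move=> [/allpairsP[[x'' c''] /= [? ? ->]] ? [-> -> ->]]; apply/and3P.
  move=> /and3P[? ? ?]; apply/allpairsP; exists ((x, c), th); split => //=.
  by apply/allpairsP; exists (x, c).
have lP x c th : (x, c, th) \in Q ->
    0 < l (x, c, th) /\ ((l (x, c, th))%:E < KL (F c x) (F th x))%E.
  rewrite QP => /and4P[cnth xX cth thth]; have /andP[K0 Koo] := KL_bounds cth thth xX cnth.
  have Kfin : KL (F c x) (F th x) \is a fin_num by rewrite ge0_fin_numE// ltW.
  rewrite /l; case: ifPn => [/and3P[/eqP -> /eqP -> bth]|_].
    by split => //; exact: K_lt.
  have f0 : 0 < fine (KL (F c x) (F th x)) by rewrite -lte_fin fineK.
  split; first by rewrite divr_gt0.
  by rewrite -[ltRHS]fineK// lte_fin ltr_pdivrMr// mulr_natr mulr2n ltrDl.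
have [s s01 sP] : exists2 s, 0 < s <= 1 & forall q, q \in Q -> forall s', 0 < s' <= s ->
    upper_mean (F q.1.2 q.1.1) (fun y => (f q.2 q.1.1 y / f q.1.2 q.1.1 y) `^ s') (1 - s' * l q).
  apply: exists_uniform_pos => [q s s' /andP[s0 ss] H s'' /andP[s''0 s''s]|[[x c] th] qQ].
    by apply: H; rewrite s''0 (le_trans s''s).
  have [_ lK] := lP _ _ _ qQ; move: qQ; rewrite QP => /and4P[cnth xX cth thth].
  by have [s0 /andP[s00 _] H] := power_small cth thth xX cnth lK; exists s0.
have [lm /andP[lm0 _] lmP] : exists2 s : R, 0 < s <= 1 & forall q, q \in Q -> s <= l q.
  apply: exists_uniform_pos => [q u u' /andP[_ uu] /(le_trans uu)//|[[x c] th] qQ].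
  by exists (l (x, c, th)) => //; have [] := lP _ _ _ qQ.
have [pm /andP[pm0 _] pmP] : exists2 s : R, 0 < s <= 1 &
    forall x, x \in xs -> s <= fine (G [set x]).
  apply: exists_uniform_pos => [q u u' /andP[_ uu] /(le_trans uu)//|x xX].
  exists (fine (G [set x])) => //; rewrite -lte_fin fineK ?fin_num_measure//.
  exact: G_gt0.
have /andP[s0 s1] := s01.
(* The entry [2^-1] keeps [rho] positive. *)
pose rho := Num.max (2^-1) (1 - s * lm).
have rho0 : 0 < rho by rewrite lt_max invr_gt0 ltr0n.
have rho1 : rho < 1.
  rewrite gt_max; apply/andP; split; first by rewrite invf_lt1// ltr1n.
  by rewrite ltrBlDr ltrDl mulr_gt0.
have pow c x th : x \in xs -> c \in ths -> th \in ths -> th != c ->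
    upper_mean (F c x) (fun y => (f th x y / f c x y) `^ s) rho.
  move=> xX cth thth thc; have qQ : (x, c, th) \in Q by rewrite QP eq_sym thc xX cth.
  apply: upper_mean_le (sP _ qQ s _) => //; last by rewrite s0 lexx.
  rewrite /rho le_max; apply/orP; right; rewrite lerD2l lerN2 ler_wpM2l ?(ltW s0)//.
  exact: lmP.
exists ((size ths)%:R * ((1 - rho)^-1 *+ 2 + 1 + ((1 - rho) * pm)^-1)
  + (s * K)^-1 * (1 + ln (size ths)%:R)) => T; have M1 : 1 <= threshold T :> R.
  rewrite -[leLHS]mulr1; apply: ler_pM => //; first by rewrite ler1n.
  by rewrite expr_ge1 ?addr_ge0 ?lerDl ?ln_ge0 ?ler1n.
(* With [kappa = s * K] and [M = threshold T], the exponent [s] cancels in the main term. *)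
apply: le_trans (@ETinf_le _ ths xs f xstar F C i (fun x => fine (G [set x]))
   pm s rho (s * K) (threshold T) T _ _ _ _ _ _ _ _ _ _ _ _ _ _ _ _ _ _ _ _ _ G _) _ => //.
- by move=> x xX; apply: mean_lt.
- exact: mulr_gt0.
- by move=> x th xX thth tha; exact: pow.
- by move=> x th xX thth tha; exact: pow.
- move=> x th xX thth; apply: upper_mean_self; last exact: f_ratio.
    exact: measurable_fun_ratio.
  by move=> y; rewrite divr_ge0// ltW.
- move=> th thth bth.
  have qQ : (x0, a, th) \in Q.
    by rewrite QP lt_eqF ?(lt_trans arm_lt)// xstar_xs C_ths.
  have := sP _ qQ s; rewrite s0 lexx => /(_ isT).
  by rewrite /l !eqxx bth.
- exact: threshold_gt0.
- by move=> t tT; apply: threshold_le; exact: ltnW.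
by rewrite lee_fin (mulrDr (s * K)^-1) addrA lerD2l invfM -mulrA mulrCA mulKf// gt_eqF.
Qed.

End configuration.
End regret.

(** * Equal parameters, and logarithmic asymptotics *)

Lemma ETinf_diag (R : realType) (xs : seq R) (G : probability R R)
  (F : R -> R -> probability R R) (phi : rule R) (C : R * R) t :
  uniq xs -> \sum_(x <- xs) fine (G [set x]) = 1 -> C.1 = C.2 ->
  (ETinf [set` xs] G F phi C t <= 0)%E.
Proof.
move=> uxs G1 C12.
have armE k : arm C k = C.1 by rewrite /arm C12; case: k.
apply: le_trans (@Eh_potential _ xs G F phi C uxs t (fun=> 0) _ _ _ t [::] _) _ => //.
- move=> h _; exists (fun=> 0) => [x _|]; first exact: upper_mean_cst.
  by rewrite big1// => x _; rewrite /inferior !armE ltxx addr0 mulr0.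
- by rewrite /= addr0.
Qed.

Lemma limn_esup_le (R : realType) (u : nat -> \bar R) (c : \bar R) N :
  (forall n, (N <= n)%N -> (u n <= c)%E) -> (limn_esup u <= c)%E.
Proof.
move=> H; rewrite limn_esup_lim; apply: lime_le; first exact: is_cvg_esups.
exists N => // n /= Nn; apply: ge_ereal_sup => _ [m /= nm <-].
by apply: H; exact: leq_trans nm.
Qed.

Lemma ln_nat_ge (R : realType) (z : R) : exists N, forall t, (N <= t)%N -> z <= ln t%:R.
Proof.
exists (Num.bound (expR z)) => t Nt.
have zt : expR z < t%:R.
  apply: lt_le_trans (archi_boundP (ltW (expR_gt0 z))) _.
  by rewrite ler_nat.
rewrite -[leLHS]expRK ler_ln ?posrE ?expR_gt0 ?ltW//.
exact: lt_trans (expR_gt0 z) zt.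
Qed.

(** Write [t ^ al] as [z * z] with [z = t ^ (al / 2)]: one factor exceeds [B], the other dominates
    [h * ln t]. *)
Lemma ln_little_o_power (R : realType) (c k al e : R) : 0 <= k -> 0 < al -> 0 < e ->
  exists N, forall t, (N <= t)%N -> c + k * ln t%:R <= e * t%:R `^ al.
Proof.
move=> k0 a0 e0.
pose h := al / 2; have h0 : 0 < h by rewrite divr_gt0.
pose B := (`|c| + k / h) / e; have B0 : 0 <= B.
  by rewrite divr_ge0 ?(ltW e0)// addr_ge0// divr_ge0// ltW.
have [N HN] := ln_nat_ge (Num.max 0 (B / h)).
exists (maxn N 1) => t; rewrite geq_max => /andP[/HN Ht t1].
have t0 : 0 < t%:R :> R by rewrite ltr0n.
move: Ht; rewrite ge_max => /andP[L0 LB].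
have Bz' : B <= h * ln t%:R by rewrite mulrC -ler_pdivrMr.
pose z := t%:R `^ h; have z0 : 0 < z by exact: powR_gt0.
have lnz : ln z = h * ln t%:R by rewrite ln_powR.
have zE : t%:R `^ al = z * z.
  rewrite /z -powRD; last by apply/implyP => _; rewrite gt_eqF.
  by congr (_ `^ _); rewrite /h; field.
have Lz : h * ln t%:R <= z by rewrite -lnz ltW// ln_sublinear.
have z1 : 1 <= z.
  by rewrite -(expR0 R) -[leRHS]lnK ?posrE// ler_expR lnz mulr_ge0// ltW.
rewrite zE; apply: (@le_trans _ _ (e * B * z)); last first.
  by rewrite mulrA ler_wpM2r ?(ltW z0)// ler_wpM2l ?(ltW e0)// (le_trans Bz').
have -> : e * B = `|c| + k / h by rewrite /B mulrC divfK// gt_eqF.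
rewrite mulrDl; apply: lerD.
  by rewrite (le_trans (ler_norm c))// ler_peMr.
by rewrite -mulrA ler_wpM2l// ler_pdivlMl.
Qed.

Lemma uniq_seq_of_finite_set (R : realType) (A : set R) : finite_set A ->
  exists2 r : seq R, uniq r & A = [set` r].
Proof.
move=> /finite_seqP[r ->]; exists (undup r); first exact: undup_uniq.
by apply/seteqP; split => x /=; rewrite mem_undup.
Qed.

Lemma sum_point_masses (R : realType) (G : probability R R) (xs : seq R) : uniq xs ->
  G [set` xs] = 1%E -> \sum_(x <- xs) fine (G [set x]) = 1.
Proof.
move=> uxs G1; apply: EFin_inj; rewrite -G1 -sumEFin.
under eq_bigr do rewrite fineK ?fin_num_measure//.
rewrite (_ : [set` xs] = \bigcup_(x in [set` xs]) [set x]); last first.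
  by apply/seteqP; split => x /=; [exists x|move=> [y yxs ->]].
rewrite measure_fin_bigcup//; [by rewrite -fsbig_seq|exact: finite_seq|].
by move=> x y _ _ [z [-> ->]].
Qed.

Theorem theorem6 (R : realType) (Theta Xs : set R) (G : probability R R)
  (F : R -> R -> probability R R) :
  (* (b) X finite, P_G(X_t = x) > 0, and G is a law on X *)
  finite_set Xs ->
  G Xs = 1%E ->
  (forall x, Xs x -> (0 < G [set x])%E) ->
  (* (c) 0 < I(theta, theta' | x) < oo *)
  (forall th th' x, Theta th -> Theta th' -> Xs x -> th != th' ->
     (0 < KL (F th x) (F th' x) < +oo)%E) ->
  (* (d) mu_theta(x) well defined and strictly increasing in theta *)
  (forall th x, Theta th -> Xs x -> (F th x).-integrable setT (fun y => y%:E)) ->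
  (forall th th' x, Theta th -> Theta th' -> Xs x -> th < th' ->
     (mean (F th x) < mean (F th' x))%E) ->
  (* (e) Theta finite *)
  finite_set Theta ->
  (* (f) minimax equality, and symmetrically *)
  (forall th1 th2, Theta th1 -> Theta th2 -> th1 < th2 ->
     infsup Theta Xs F th1 th2 = supinf Theta Xs F th1 th2) ->
  (forall th1 th2, Theta th1 -> Theta th2 -> th2 < th1 ->
     infsup Theta Xs F th2 th1 = supinf Theta Xs F th2 th1) ->
  exists phi : rule R,
    rule_measurable phi /\
    uniformly_good Theta Xs G F phi /\
    forall th1 th2, Theta th1 -> Theta th2 -> th1 != th2 ->
      (limn_esup (fun t : nat =>
          ETinf Xs G F phi (th1, th2) t * ((ln (t%:R : R))^-1)%:E)
        <= einv (Kconst Theta Xs F (th1, th2)))%E.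
Proof.
move=> /uniq_seq_of_finite_set[xs uxs ->] G1 G0 KLb _ mlt
  /uniq_seq_of_finite_set[ths _ ThetaE] minimax _; subst Theta.
have G_sum := sum_point_masses uxs G1.
have xs0 : xs != [::].
  by apply/eqP => xsE; move: G_sum; rewrite xsE big_nil => /eqP; rewrite eq_sym oner_eq0.
have /choice[f fP] : forall x, exists g : R -> R -> R,
    [/\ forall th, measurable_fun setT (g th), forall th y, 0 < g th y &
      x \in xs -> forall c th, c \in ths -> th \in ths ->
        (\int[F c x]_y (g th y / g c y)%:E <= 1)%E /\
        KL (F c x) (F th x) = (\int[F c x]_y (- ln (g th y / g c y))%:E)%E].
  move=> x.
  have [xX|xX] := boolP (x \in xs); last by exists (fun _ _ => 1).
  have [|g [mg g0 g1 gKL]] := @exists_densities R [set` ths] (fun th => F th x).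
    (* A number [KL] below [+oo] forces absolute continuity. *)
    move=> c th /= cth thth; have [->//|cnth] := eqVneq c th.
    have /andP[_] := KLb _ _ _ cth thth xX cnth.
    by rewrite /KL; case: pselect.
  by exists g; split => // _ c th cth thth; split; [exact: g1|exact: gKL].
(* The exploration point maximises over [x] the infimum of the Kullback-Leibler numbers; the minimax
   equality turns its value into [infsup]. *)
have /choice[xst xstP] : forall q : R * R, exists x, x \in xs /\
    (q.1 \in ths -> q.2 \in ths -> q.1 < q.2 -> forall th, th \in ths -> q.2 < th ->
      (infsup [set` ths] [set` xs] F q.1 q.2 <= KL (F q.1 x) (F th x))%E).
  move=> [c d] /=.
  pose v x := ereal_inf [set KL (F c x) (F th x)
                           | th in [set th | [set` ths] th /\ d < th]].
  have [x xX xP] := exists_argmax v xs0.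
  exists x; split => // cth dth cd th thth dlt; rewrite minimax//.
  apply: (@le_trans _ _ (v x)).
    by apply: ge_ereal_sup => _ [x' /= x'X <-]; exact: xP.
  by apply: ereal_inf_lbound; exists th.
pose xstar c d := xst (c, d).
pose phi := likelihood_rule ths (fun th x y => f x th y) xstar.
have bound C : C.1 \in ths -> C.2 \in ths -> C.1 != C.2 -> exists2 k0 : R, 0 <= k0 &
    einv (Kconst [set` ths] [set` xs] F C) = k0%:E /\
    forall eta, 0 < eta -> exists c, forall t, (0 < t)%N ->
      (ETinf [set` xs] G F phi C t <= (c + (k0 + eta) * ln t%:R)%:E)%E.
  (* Both orders are treated at once: [i] is the arm with the smaller parameter. *)
  move=> C1 C2 C12; pose i := ~~ (C.1 < C.2).
  have Cths k : arm C k \in ths by case: k.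
  have alt : arm C i < arm C (~~ i).
    rewrite /arm /i negbK; case: (ltP C.1 C.2) => //= C21.
    by rewrite lt_neqAle eq_sym C12.
  set a := arm C i in alt *; set b := arm C (~~ i) in alt *.
  have KE : Kconst [set` ths] [set` xs] F C = infsup [set` ths] [set` xs] F a b.
    by rewrite /Kconst /a /b /arm /i negbK; case: (ltP C.1 C.2).
  set K := infsup _ _ _ _ _ in KE.
  have Kst th : th \in ths -> b < th -> (K <= KL (F a (xstar a b)) (F th (xstar a b)))%E.
    exact: (xstP (a, b)).2 (Cths i) (Cths (~~ i)) alt th.
  have K0 : (0 < K)%E.
    have [m /andP[m0 _] mP] : exists2 m : R, 0 < m <= 1 & forall th, th \in ths -> b < th ->
        (m%:E <= KL (F a (xstar a b)) (F th (xstar a b)))%E.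
      apply: exists_uniform_pos => [q u u' /andP[_ uu] H bq|th thth].
        by rewrite (le_trans _ (H bq))// lee_fin.
      have [bth|bth] := boolP (b < th); last by exists 1.
      have anth : a != th by rewrite lt_eqF// (lt_trans alt).
      have /andP[k0 koo] := KLb _ _ _ (Cths i) thth (xstP (a, b)).1 anth.
      have kfin : KL (F a (xstar a b)) (F th (xstar a b)) \is a fin_num.
        by rewrite ge0_fin_numE// ltW.
      exists (fine (KL (F a (xstar a b)) (F th (xstar a b)))); first by rewrite -lte_fin fineK.
      by rewrite fineK.
    apply: (@lt_le_trans _ _ m%:E); first by rewrite lte_fin.
    apply: le_ereal_inf_tmp => _ [th /= [thth bth] <-].
    apply: le_trans (mP _ thth bth) _; apply: ereal_sup_ubound.
    by exists (xstar a b) => //=; exact: (xstP (a, b)).1.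
  pose k0 := fine (einv K).
  have k0ge : 0 <= k0.
    by move: K0; rewrite /k0; case: (K) => //= r; rewrite lte_fin invr_ge0 => /ltW.
  exists k0 => //; split; first by rewrite KE /k0; case: (K).
  (* Finite and strictly below [K], also when [K] is infinite and [k0 = 0]; half of [eta] is kept
     for the double logarithm. *)
  move=> eta eta0; pose K' := (k0 + eta / 2)^-1.
  have ke : 0 < k0 + eta / 2 by rewrite ltr_wpDl// divr_gt0.
  have K'0 : 0 < K' by rewrite invr_gt0.
  have K'K : (K'%:E < K)%E.
    move: K0; rewrite /K' /k0 /=; case: (K) => //= [r|_]; last by rewrite ltry.
    rewrite !lte_fin => r0; rewrite invf_plt ?posrE//.
      by rewrite ltrDl divr_gt0.
    by rewrite addr_gt0 ?invr_gt0// divr_gt0.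
  have [c Hc] := @ETinf_le_ln_threshold R ths xs G F (fun th x y => f x th y) xstar
    uxs G0 G_sum (fun c th x ct tt xX => KLb c th x ct tt xX)
    (fun c th x ct tt xX => mlt c th x ct tt xX)
    (fun th x y => let: And3 _ h _ := fP x in h th y)
    (fun th x => let: And3 h _ _ := fP x in h th)
    (fun c th x ct tt xX => let: And3 _ _ h := fP x in (h xX c th ct tt).1)
    (fun c th x ct tt xX => let: And3 _ _ h := fP x in (h xX c th ct tt).2)
    (fun c d => (xstP (c, d)).1) C i Cths alt K' K'0
    (fun th thth bth => lt_le_trans K'K (Kst th thth bth)).
  (* Solves [(k0 + eta / 2) * (1 + 2 * delta) = k0 + eta]. *)
  pose delta := (eta / 2) / (2 * (k0 + eta / 2)).
  have d0 : 0 < delta by rewrite divr_gt0// ?divr_gt0// mulr_gt0.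
  have [c' Hc'] := ln_threshold_le d0.
  exists (c + (k0 + eta / 2) * c') => t t0; apply: le_trans (Hc t) _.
  rewrite lee_fin -addrA lerD2l /K' invrK.
  have -> : k0 + eta = (k0 + eta / 2) * (1 + 2 * delta).
    have [q qE] : {q | q = k0 + eta / 2} by exists (k0 + eta / 2).
    rewrite /delta -qE; have q0 : 0 < q by rewrite qE.
    have -> : k0 = q - eta / 2 by rewrite qE addrK.
    by field; rewrite gt_eqF.
  by rewrite -mulrA -mulrDr ler_wpM2l ?(ltW ke)// Hc'.
exists phi; split.
  apply: likelihood_rule_measurable => th x.
  by have [] := fP x.
split.
  move=> C C1 C2 al al0 e e0; have [C12|C12] := eqVneq C.1 C.2.
    exists 0%N => t _; apply: le_trans (ETinf_diag _ _ _ uxs G_sum C12) _.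
    by rewrite lee_fin mulr_ge0 ?powR_ge0// ltW.
  have [k0 k00 [_ /(_ _ ltr01)[c Hc]]] := bound C C1 C2 C12.
  have [N HN] := @ln_little_o_power R c (k0 + 1) al e (addr_ge0 k00 ler01) al0 e0.
  exists (maxn N 1) => t; rewrite geq_max => /andP[Nt t0].
  by apply: le_trans (Hc t t0) _; rewrite lee_fin HN.
move=> th1 th2 T1 T2 th12; have [k0 k00 [-> H]] := bound (th1, th2) T1 T2 th12.
apply/lee_addgt0Pr => eta eta0.
have eta2 : 0 < eta / 2 by rewrite divr_gt0.
have [c Hc] := H _ eta2.
(* The entry [1] makes [ln t] positive; the other absorbs [c] into [eta / 2 * ln t]. *)
have [N HN] := ln_nat_ge (Num.max 1 (c / (eta / 2))).
apply: (@limn_esup_le _ _ _ (maxn N 1)) => t; rewrite geq_max => /andP[/HN Lt t0].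
move: Lt; rewrite ge_max => /andP[L1 Lc].
have L0 : 0 < ln t%:R :> R by exact: lt_le_trans L1.
apply: (@le_trans _ _ ((c + (k0 + eta / 2) * ln t%:R)%:E * ((ln t%:R)^-1)%:E)%E).
  by apply: lee_wpmul2r; [rewrite lee_fin invr_ge0 ltW|exact: Hc].
rewrite -EFinM -EFinD lee_fin ler_pdivrMr//.
have : c <= (eta / 2) * ln t%:R by rewrite mulrC -ler_pdivrMr.
have -> : (k0 + eta) * ln t%:R = (eta / 2) * ln t%:R + (k0 + eta / 2) * ln t%:R by field.
by rewrite lerD2r.
Qed.
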